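(* Let $Q\in\mathbb{C}^{N\times N}$ be a matrix all of whose eigenvalues have positive real part, and let $n\ge 0$ be an integer. Then for every $x>0$ $$\frac{d^{n}}{dx^{n}}\big[x^{-Q}\Gamma(Q,x)\big]=(-1)^{n}x^{-Q-nI}\,\Gamma(Q+nI,x),$$ $$\frac{d^{n}}{dx^{n}}\big[x^{-Q}\gamma(Q,x)\big]=(-1)^{n}x^{-Q-nI}\,\gamma(Q+nI,x),$$ $$\frac{d^{n}}{dx^{n}}\big[e^{x}\Gamma(Q,x)\big]=(-1)^{n}(I-Q)_{n}\,e^{x}\,\Gamma(Q-nI,x),$$ and, if in addition all eigenvalues of $Q$ have real part greater than $n$ (so that $\gamma(Q-nI,x)$ is defined), $$\frac{d^{n}}{dx^{n}}\big[e^{x}\gamma(Q,x)\big]=(-1)^{n}(I-Q)_{n}\,e^{x}\,\gamma(Q-nI,x).$$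
   Context: $I$ is the identity matrix in $\mathbb{C}^{N\times N}$, and $t^{M}=\exp(M\ln t)$ for $t>0$ and $M\in\mathbb{C}^{N\times N}$. For $x>0$ the incomplete gamma matrix functions are $$\gamma(M,x)=\int_0^x u^{M-I}e^{-u}\,du,\qquad \Gamma(M,x)=\int_x^\infty u^{M-I}e^{-u}\,du ,$$ where for $\gamma(M,x)$ all eigenvalues of $M$ have positive real part (the integral defining $\Gamma(M,x)$ converges for every $M\in\mathbb{C}^{N\times N}$ when $x>0$). The Pochhammer symbol of a matrix $M$ is $(M)_0=I$ and $(M)_n=M(M+I)\cdots(M+(n-1)I)$ for $n\ge1$. *)

(* Defs.v *)
From mathcomp Require Import all_boot all_order all_algebra.
From mathcomp Require Import complex.
From mathcomp Require Import all_classical all_reals all_analysis.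

Set Implicit Arguments.
Unset Strict Implicit.
Unset Printing Implicit Defensive.

Import Order.TTheory GRing.Theory Num.Theory.
Import numFieldNormedType.Exports.

Local Open Scope classical_set_scope.
Local Open Scope complex_scope.
Local Open Scope ring_scope.

(* Limits, derivatives and integrals of complex matrices are taken on the real
   and imaginary parts: ['M[R]_N] is a normed [R]-module in the library,
   whereas [R[i]] and ['M[R[i]]_N] are not. *)
Definition Re_mx (R : realType) (N : nat) (A : 'M[R[i]]_N) : 'M[R]_N :=
  map_mx (@complex.Re R) A.

Definition Im_mx (R : realType) (N : nat) (A : 'M[R[i]]_N) : 'M[R]_N :=
  map_mx (@complex.Im R) A.

Definition complex_mx (R : realType) (N : nat) (A B : 'M[R]_N) : 'M[R[i]]_N :=
  \matrix_(i, j) (A i j +i* B i j).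

Definition exp_mx (R : realType) (N : nat) (A : 'M[R[i]]_N) : 'M[R[i]]_N :=
  let a := fun k : nat => (k`!%:R)^-1 *: A ^+ k in
  complex_mx (limn (series (fun k => Re_mx (a k))))
             (limn (series (fun k => Im_mx (a k)))).

(* t^M, for t > 0 *)
Definition rpow_mx (R : realType) (N : nat) (t : R) (M : 'M[R[i]]_N) :
    'M[R[i]]_N :=
  exp_mx ((ln t)%:C *: M).

(* Entrywise Lebesgue integral.  The integrals of interest converge absolutely,
   so that it agrees with the improper Riemann integral. *)
Definition integral_mx (R : realType) (N : nat) (D : set R)
    (F : R -> 'M[R[i]]_N) : 'M[R[i]]_N :=
  \matrix_(i, j)
    ((\int[lebesgue_measure]_(u in D) complex.Re (F u i j))%R +i*
     (\int[lebesgue_measure]_(u in D) complex.Im (F u i j))%R).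

Definition lower_gamma_mx (R : realType) (N : nat) (M : 'M[R[i]]_N) (x : R) :
    'M[R[i]]_N :=
  integral_mx `]0, x] (fun u => (expR (- u))%:C *: rpow_mx u (M - 1%:M)).

Definition upper_gamma_mx (R : realType) (N : nat) (M : 'M[R[i]]_N) (x : R) :
    'M[R[i]]_N :=
  integral_mx `[x, +oo[ (fun u => (expR (- u))%:C *: rpow_mx u (M - 1%:M)).

Definition pochhammer_mx (R : realType) (N : nat) (M : 'M[R[i]]_N) (n : nat) :
    'M[R[i]]_N :=
  \prod_(k < n) (M + (k%:R)%:M).

Definition nderive_cmx (R : realType) (N n : nat) (F : R -> 'M[R[i]]_N) (x : R) :
    'M[R[i]]_N :=
  complex_mx (derive1n n (fun y => Re_mx (F y)) x)
             (derive1n n (fun y => Im_mx (F y)) x).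

(* [derive1n] is total: [nderive_cmx n F x] is meaningful when F is n times
   differentiable around x. *)
Definition nderivable_cmx (R : realType) (N n : nat) (F : R -> 'M[R[i]]_N)
    (x : R) : Prop :=
  \forall y \near x, forall k : nat, (k < n)%N ->
    derivable (derive1n k (fun z => Re_mx (F z))) y 1 /\
    derivable (derive1n k (fun z => Im_mx (F z))) y 1.

Definition eigenvalues_Re_gt (R : realType) (N : nat) (M : 'M[R[i]]_N) (r : R) :
    Prop :=
  forall a : R[i], eigenvalue M a -> r < complex.Re a.

(* Main.v *)
(* The matrix power t^M = exp(M ln t) satisfies d/dt t^M = t^-1 M t^M, and the
   incomplete gamma functions satisfy d/dx gamma(M,x) = k(M,x) and
   d/dx Gamma(M,x) = -k(M,x), with k(M,x) = e^-x x^(M-I).  Hence in the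
   recurrences gamma(M+I,x) = M gamma(M,x) - x^M e^-x and
   Gamma(M+I,x) = M Gamma(M,x) + x^M e^-x the two sides have the same derivative,
   and they agree because their difference tends to 0 as x -> 0, respectively
   x -> oo.  Each of the four identities follows by induction on n from these
   recurrences.

   Convergence of the integrals at 0 rests on |exp(sM)| <= K e^(ds) for s <= 0
   with some d > 0.  It is obtained without a Jordan form: by Cayley-Hamilton a
   product of factors M - r_j kills exp(sM), and the factors are peeled off one
   at a time, each of them reducing to a scalar equation y' = r y + z with
   Re r > d and z = O(e^(ds)). *)
Require Import Defs.
From mathcomp Require Import all_boot all_order all_algebra.
From mathcomp Require Import complex.
From mathcomp Require Import all_classical all_reals all_analysis.
From mathcomp Require Import measurable_realfun ring lra.

Import Order.TTheory GRing.Theory Num.Theory.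
Import numFieldNormedType.Exports.

Local Open Scope complex_scope.
Local Open Scope ring_scope.

Set Implicit Arguments.
Unset Strict Implicit.
Unset Printing Implicit Defensive.

(** * Derivatives of complex matrices *)

Section ComplexDerivative.
Variable R : realType.
Implicit Types (f g : R -> R[i]) (c : R -> R) (x : R).

(** Split into two real derivatives, so that real calculus applies to functions of a real variable
    with values in [R[i]]. *)
Definition is_cderive f x (l : R[i]) : Prop :=
  is_derive x 1 (fun t => complex.Re (f t)) (complex.Re l) /\
  is_derive x 1 (fun t => complex.Im (f t)) (complex.Im l).

Lemma ReM (a b : R[i]) : complex.Re (a * b) =
  complex.Re a * complex.Re b - complex.Im a * complex.Im b.
Proof. by case: a b => [? ?] []. Qed.

Lemma ImM (a b : R[i]) : complex.Im (a * b) =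
  complex.Re a * complex.Im b + complex.Im a * complex.Re b.
Proof. by case: a b => [? ?] []. Qed.

Lemma is_cderive_cst a x : is_cderive (fun=> a) x 0.
Proof. by split; exact: is_derive_cst. Qed.

Lemma is_cderiveD f g x a b : is_cderive f x a -> is_cderive g x b ->
  is_cderive (fun t => f t + g t) x (a + b).
Proof.
move=> [fr fi] [gr gi]; split; rewrite raddfD.
  under eq_fun do rewrite raddfD; exact: is_deriveD.
under eq_fun do rewrite raddfD; exact: is_deriveD.
Qed.

Lemma is_cderiveN f x a : is_cderive f x a -> is_cderive (fun t => - f t) x (- a).
Proof.
move=> [fr fi]; split; rewrite raddfN.
  under eq_fun do rewrite raddfN; exact: is_deriveN.
under eq_fun do rewrite raddfN; exact: is_deriveN.
Qed.

Lemma is_cderiveM f g x a b : is_cderive f x a -> is_cderive g x b ->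
  is_cderive (fun t => f t * g t) x (a * g x + f x * b).
Proof.
move=> [fr fi] [gr gi]; split; rewrite raddfD/= ?ReM ?ImM.
  under eq_fun do rewrite ReM.
  apply: is_derive_eq.
  by rewrite /GRing.scale/=; ring.
under eq_fun do rewrite ImM.
apply: is_derive_eq.
by rewrite /GRing.scale/=; ring.
Qed.

Lemma is_cderive_real c x d : is_derive x 1 c d ->
  is_cderive (fun t => (c t)%:C) x d%:C.
Proof. by move=> h; split => //=; exact: is_derive_cst. Qed.

Lemma is_cderive_comp f c x a d : is_cderive f (c x) a -> is_derive x 1 c d ->
  is_cderive (fun t => f (c t)) x (d%:C * a).
Proof.
move=> [fr fi] h; rewrite /is_cderive ReM ImM/= !mul0r subr0 addr0 ![d * _]mulrC.
by split; [exact: (is_derive1_comp fr h)|exact: (is_derive1_comp fi h)].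
Qed.

Lemma is_cderive_sum (I : finType) (F : I -> R -> R[i]) x (a : I -> R[i]) :
  (forall i, is_cderive (F i) x (a i)) ->
  is_cderive (fun t => \sum_i F i t) x (\sum_i a i).
Proof.
move=> h; rewrite /index_enum; elim: (Finite.enum _) => [|i s ih].
  by under eq_fun do rewrite big_nil; rewrite big_nil; exact: is_cderive_cst.
by under eq_fun do rewrite big_cons; rewrite big_cons; exact: is_cderiveD.
Qed.

Lemma is_cderive0_cst f : (forall x, is_cderive f x 0) -> forall x y, f x = f y.
Proof.
move=> h x y; apply/eqP; rewrite eq_complex; apply/andP; split; apply/eqP.
  by apply: (@is_derive_0_is_cst _ (fun t => complex.Re (f t))) => t; case: (h t).
by apply: (@is_derive_0_is_cst _ (fun t => complex.Im (f t))) => t; case: (h t).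
Qed.

Definition is_mxderive m n (F : R -> 'M[R[i]]_(m, n)) x (L : 'M[R[i]]_(m, n)) :
    Prop :=
  forall i j, is_cderive (fun t => F t i j) x (L i j).

Lemma is_mxderive_eq m n (F : R -> 'M[R[i]]_(m, n)) x L L' :
  is_mxderive F x L -> L = L' -> is_mxderive F x L'.
Proof. by move=> h <-. Qed.

Lemma is_mxderive_cst m n (A : 'M[R[i]]_(m, n)) x : is_mxderive (fun=> A) x 0.
Proof. by move=> i j; rewrite mxE; exact: is_cderive_cst. Qed.

Lemma is_mxderiveD m n (F G : R -> 'M[R[i]]_(m, n)) x A B :
  is_mxderive F x A -> is_mxderive G x B ->
  is_mxderive (fun t => F t + G t) x (A + B).
Proof.
move=> hF hG i j; rewrite mxE; under eq_fun do rewrite mxE.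
exact: is_cderiveD.
Qed.

Lemma is_mxderiveN m n (F : R -> 'M[R[i]]_(m, n)) x A :
  is_mxderive F x A -> is_mxderive (fun t => - F t) x (- A).
Proof.
move=> hF i j; rewrite mxE; under eq_fun do rewrite mxE.
exact: is_cderiveN.
Qed.

Lemma is_mxderiveM m n p (F : R -> 'M[R[i]]_(m, n)) (G : R -> 'M[R[i]]_(n, p)) x
    A B :
  is_mxderive F x A -> is_mxderive G x B ->
  is_mxderive (fun t => F t *m G t) x (A *m G x + F x *m B).
Proof.
move=> hF hG i j; rewrite !mxE -big_split/=; under eq_fun do rewrite mxE.
by apply: is_cderive_sum => k; exact: is_cderiveM.
Qed.

Lemma is_mxderiveMl m n p (A : 'M[R[i]]_(m, n)) (G : R -> 'M[R[i]]_(n, p)) x B :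
  is_mxderive G x B -> is_mxderive (fun t => A *m G t) x (A *m B).
Proof.
move=> hG; apply: is_mxderive_eq (is_mxderiveM (is_mxderive_cst A x) hG) _.
by rewrite mul0mx add0r.
Qed.

Lemma is_mxderiveZ m n f (F : R -> 'M[R[i]]_(m, n)) x a A :
  is_cderive f x a -> is_mxderive F x A ->
  is_mxderive (fun t => f t *: F t) x (a *: F x + f x *: A).
Proof.
move=> hf hF i j; rewrite !mxE; under eq_fun do rewrite mxE.
exact: is_cderiveM.
Qed.

Lemma is_mxderive_comp m n (F : R -> 'M[R[i]]_(m, n)) c x A d :
  is_mxderive F (c x) A -> is_derive x 1 c d ->
  is_mxderive (fun t => F (c t)) x (d%:C *: A).
Proof.
by move=> hF hc i j; rewrite mxE; apply: (is_cderive_comp (hF i j)).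
Qed.

Lemma is_mxderive0_cst m n (F : R -> 'M[R[i]]_(m, n)) :
  (forall x, is_mxderive F x 0) -> forall x y, F x = F y.
Proof.
move=> h x y; apply/matrixP => i j.
apply: (@is_cderive0_cst (fun t => F t i j)) => t.
by have := h t i j; rewrite mxE.
Qed.

End ComplexDerivative.

(** * The matrix exponential *)

Section MatrixExponential.
Variable R : realType.
Local Open Scope classical_set_scope.

Definition is_ccvg (u : nat -> R[i]) (l : R[i]) : Prop :=
  (complex.Re (u n) @[n --> \oo] --> complex.Re l) /\
  (complex.Im (u n) @[n --> \oo] --> complex.Im l).

Lemma is_ccvgD u v a b : is_ccvg u a -> is_ccvg v b ->
  is_ccvg (fun n => u n + v n) (a + b).
Proof.
move=> [ur ui] [vr vi]; split; rewrite raddfD.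
  by under eq_fun do rewrite raddfD; exact: cvgD.
by under eq_fun do rewrite raddfD; exact: cvgD.
Qed.

Lemma is_ccvgMl c u a : is_ccvg u a -> is_ccvg (fun n => c * u n) (c * a).
Proof.
move=> [ur ui]; split; rewrite ?ReM ?ImM.
  under eq_fun do rewrite ReM.
  by apply: cvgB; apply: cvgM => //; exact: cvg_cst.
under eq_fun do rewrite ImM.
by apply: cvgD; apply: cvgM => //; exact: cvg_cst.
Qed.

Lemma is_ccvg_sum (I : finType) (F : I -> nat -> R[i]) (a : I -> R[i]) :
  (forall i, is_ccvg (F i) (a i)) ->
  is_ccvg (fun n => \sum_i F i n) (\sum_i a i).
Proof.
move=> h; rewrite /index_enum; elim: (Finite.enum _) => [|i s ih].
  by under eq_fun do rewrite big_nil; rewrite big_nil; split; exact: cvg_cst.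
by under eq_fun do rewrite big_cons; rewrite big_cons; exact: is_ccvgD.
Qed.

(* A real-valued norm, whereas [`|z|] lives in [R[i]]. *)
Definition taxicab (z : R[i]) : R := `|complex.Re z| + `|complex.Im z|.

Lemma taxicab_ge0 z : 0 <= taxicab z.
Proof. by rewrite addr_ge0. Qed.

Lemma taxicabD z w : taxicab (z + w) <= taxicab z + taxicab w.
Proof.
by rewrite /taxicab !raddfD/= addrACA lerD// ler_normD.
Qed.

Lemma taxicabM z w : taxicab (z * w) <= taxicab z * taxicab w.
Proof.
rewrite /taxicab ReM ImM mulrDl !mulrDr -!normrM.
apply: (le_trans (lerD (ler_normB _ _) (ler_normD _ _))).
by rewrite le_eqVlt; apply/orP; left; apply/eqP; ring.
Qed.

Lemma taxicab_real_mul (c : R) z : taxicab (c%:C * z) = `|c| * taxicab z.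
Proof.
by rewrite /taxicab ReM ImM/= !mul0r subr0 addr0 !normrM mulrDr.
Qed.

Lemma taxicab_sum (I : finType) (F : I -> R[i]) :
  taxicab (\sum_i F i) <= \sum_i taxicab (F i).
Proof.
rewrite /index_enum; elim: (Finite.enum _) => [|i s ih].
  by rewrite !big_nil /taxicab/= normr0 addr0.
by rewrite !big_cons (le_trans (taxicabD _ _))// lerD2l.
Qed.

Lemma Re_le_taxicab z : `|complex.Re z| <= taxicab z.
Proof. by rewrite lerDl. Qed.

Lemma Im_le_taxicab z : `|complex.Im z| <= taxicab z.
Proof. by rewrite lerDr. Qed.

Definition mx_taxicab m n (A : 'M[R[i]]_(m, n)) : R :=
  \sum_i \sum_j taxicab (A i j).

Lemma mx_taxicab_ge0 m n (A : 'M[R[i]]_(m, n)) : 0 <= mx_taxicab A.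
Proof. by do 2 apply: sumr_ge0 => ? _; exact: taxicab_ge0. Qed.

Lemma row_taxicab_le m n (A : 'M[R[i]]_(m, n)) i :
  \sum_j taxicab (A i j) <= mx_taxicab A.
Proof.
rewrite /mx_taxicab (bigD1 i)//= lerDl; do 2 apply: sumr_ge0 => ? _.
exact: taxicab_ge0.
Qed.

Lemma taxicab_mulmx m n p (A : 'M[R[i]]_(m, n)) (B : 'M[R[i]]_(n, p)) i j K :
  (forall k, taxicab (B k j) <= K) ->
  taxicab ((A *m B) i j) <= (\sum_k taxicab (A i k)) * K.
Proof.
move=> BK; rewrite mxE (le_trans (taxicab_sum _))// mulr_suml ler_sum// => k _.
by rewrite (le_trans (taxicabM _ _))// ler_wpM2l// taxicab_ge0.
Qed.

Variable N : nat.
Implicit Types A B : 'M[R[i]]_N.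

(** Induction on [k]: an entry of [A *m A ^+ k] pairs a row of [A] with a bounded column, and every
    row sum is at most [mx_taxicab A]. *)
Lemma taxicab_expmx A k i j : taxicab ((A ^+ k) i j) <= mx_taxicab A ^+ k.
Proof.
elim: k i j => [|k ih] i j.
  rewrite !expr0 mxE; case: eqP => _ /=.
    by rewrite /taxicab/= normr1 normr0 addr0.
  by rewrite /taxicab/= normr0 addr0.
rewrite !exprS; apply: (le_trans (taxicab_mulmx _ _ (ih ^~ j))).
by rewrite ler_wpM2r ?exprn_ge0 ?mx_taxicab_ge0// row_taxicab_le.
Qed.

Lemma exprZmx (s : R[i]) A k : (s *: A) ^+ k = s ^+ k *: A ^+ k.
Proof.
elim: k => [|k ih]; first by rewrite !expr0 scale1r.
rewrite !exprS ih; transitivity ((s *: A) *m (s ^+ k *: A ^+ k)) => //.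
by rewrite -scalemxAl -scalemxAr scalerA.
Qed.

(** * Power series dominated by an exponential series *)

Section PowerSeries.
Variables (c : nat -> R) (K a : R).
Hypothesis c_bound : forall k, `|c k| <= K * (a ^+ k / k`!%:R).

(** Comparison with [K] times the series of exp(|a| |x|), which converges for every [x]. *)
Lemma is_cvg_pseries_exp x : cvgn (pseries c x).
Proof.
(* The bound at index 0 reads |c 0| <= K. *)
have K0 : 0 <= K.
  have := le_trans (normr_ge0 _) (c_bound 0).
  by rewrite expr0 mul1r invr1 mulr1.
have h := is_cvg_series_exp_coeff (`|a| * `|x|).
apply: normed_cvg; apply: (@series_le_cvg _ _ (fun n => K * exp_coeff (`|a| * `|x|) n)).
- by move=> n; exact: normr_ge0.
- move=> n; rewrite /exp_coeff/=.
  by rewrite mulr_ge0// mulr_ge0// ?invr_ge0// exprn_ge0// mulr_ge0.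
- move=> n; rewrite /exp_coeff/= normrM normrX.
  rewrite [leRHS](_ : _ = K * (`|a| ^+ n / n`!%:R) * `|x| ^+ n); last first.
    by rewrite exprMn; ring.
  rewrite ler_wpM2r ?exprn_ge0// (le_trans (c_bound n))//.
  rewrite ler_wpM2l// ler_wpM2r ?invr_ge0//.
  by rewrite -normrX ler_norm.
- exact: (@is_cvg_seriesZ _ _ K h).
Qed.

End PowerSeries.

Lemma natrM_divf_fact (x : R) k : k.+1%:R * (x / k.+1`!%:R) = x / k`!%:R.
Proof. by rewrite factS natrM invfM mulrCA mulVKf. Qed.

(** The factor k+1 cancels against (k+1)!, so formal differentiation keeps a bound of the same shape
    and can be repeated. *)
Lemma exp_pseries_diffs_bound (c : nat -> R) K a :
  (forall k, `|c k| <= K * (a ^+ k / k`!%:R)) ->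
  forall k, `|pseries_diffs c k| <= K * a * (a ^+ k / k`!%:R).
Proof.
move=> h k; rewrite /pseries_diffs normrM normr_nat.
apply: (le_trans (ler_wpM2l _ (h k.+1))) => //.
rewrite le_eqVlt; apply/orP; left; apply/eqP.
by rewrite mulrCA natrM_divf_fact exprS; ring.
Qed.

(** Termwise differentiation asks for convergence of the series and of its first two formal
    derivatives at a point beyond |x|; here |x| + 1 is taken. *)
Lemma is_derive_exp_pseries (c : nat -> R) K a x :
  (forall k, `|c k| <= K * (a ^+ k / k`!%:R)) ->
  is_derive x (1 : R) (fun s => limn (pseries c s))
    (limn (pseries (pseries_diffs c) x)).
Proof.
move=> h; have h1 := exp_pseries_diffs_bound h.
have h2 := exp_pseries_diffs_bound h1.
apply: (@pseries_snd_diffs _ _ (`|x| + 1)).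
- exact: is_cvg_pseries_exp h _.
- exact: is_cvg_pseries_exp h1 _.
- exact: is_cvg_pseries_exp h2 _.
- by rewrite [ltRHS]ger0_norm ?ltrDl// addr_ge0.
Qed.

(** The matrix norm is a maximum over finitely many entries, so entrywise convergence is convergence
    in norm. *)
Lemma lim_mxE m n (u : nat -> 'M[R]_(m, n)) :
  (forall i j, cvgn (fun k => u k i j)) ->
  limn u = \matrix_(i, j) limn (fun k => u k i j).
Proof.
move=> h; apply/cvg_lim => //=; apply/cvgrPdist_le => /= e e0; near=> k.
rewrite /Num.Def.normr/= mx_normrE (bigmax_le _ (ltW e0))//= => i _.
rewrite !mxE/=; move: i; near: k; apply: filter_forall => /= i.
exact: ((cvgrPdist_le _ _).1 (h i.1 i.2)).
Unshelve. all: by end_near. Qed.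

Lemma ReMreal (a : R) (z : R[i]) : complex.Re (a%:C * z) = a * complex.Re z.
Proof. by rewrite ReM/= mul0r subr0. Qed.

Lemma ImMreal (a : R) (z : R[i]) : complex.Im (a%:C * z) = a * complex.Im z.
Proof. by rewrite ImM/= mul0r addr0. Qed.

Let re_coef A i j k : R := complex.Re ((A ^+ k) i j) / k`!%:R.
Let im_coef A i j k : R := complex.Im ((A ^+ k) i j) / k`!%:R.

Let re_coef_bound A i j k : `|re_coef A i j k| <= 1 * (mx_taxicab A ^+ k / k`!%:R).
Proof.
rewrite mul1r normrM [`|_^-1|]ger0_norm ?invr_ge0// ler_wpM2r ?invr_ge0//.
exact: le_trans (Re_le_taxicab _) (taxicab_expmx _ _ _ _).
Qed.

Let im_coef_bound A i j k : `|im_coef A i j k| <= 1 * (mx_taxicab A ^+ k / k`!%:R).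
Proof.
rewrite mul1r normrM [`|_^-1|]ger0_norm ?invr_ge0// ler_wpM2r ?invr_ge0//.
exact: le_trans (Im_le_taxicab _) (taxicab_expmx _ _ _ _).
Qed.

Lemma exp_mx_termE A (s : R) k i j :
  ((k`!%:R)^-1 *: (s%:C *: A) ^+ k) i j =
  (s ^+ k / k`!%:R)%:C * (A ^+ k) i j.
Proof.
rewrite exprZmx !mxE mulrA; congr (_ * _).
by rewrite mulrC rmorphM/= rmorphXn fmorphV/= rmorph_nat.
Qed.

(** Turns each entry of exp(sA) into two real power series in [s], which can be differentiated
    termwise. *)
Lemma exp_mxE A (s : R) i j : exp_mx (s%:C *: A) i j =
  limn (pseries (re_coef A i j) s) +i* limn (pseries (im_coef A i j) s).
Proof.
set u := fun k : nat => (k`!%:R)^-1 *: (s%:C *: A) ^+ k.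
have reE k l : series (fun n => Re_mx (u n)) l k.1 k.2 =
    pseries (re_coef A k.1 k.2) s l.
  rewrite /pseries /series/= summxE; apply: eq_bigr => n _.
  by rewrite mxE exp_mx_termE ReMreal /re_coef; ring.
have imE k l : series (fun n => Im_mx (u n)) l k.1 k.2 =
    pseries (im_coef A k.1 k.2) s l.
  rewrite /pseries /series/= summxE; apply: eq_bigr => n _.
  by rewrite mxE exp_mx_termE ImMreal /im_coef; ring.
rewrite /exp_mx -/u mxE !lim_mxE ?mxE.
- under eq_fun do rewrite (reE (i, j)).
  by under [in X in _ +i* X]eq_fun do rewrite (imE (i, j)).
- move=> k l; under eq_fun do rewrite (imE (k, l)).
  exact: is_cvg_pseries_exp (im_coef_bound A k l) _.
- move=> k l; under eq_fun do rewrite (reE (k, l)).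
  exact: is_cvg_pseries_exp (re_coef_bound A k l) _.
Qed.

Let pseriesE A (s : R) n i j :
  pseries (re_coef A i j) s n +i* pseries (im_coef A i j) s n =
  \sum_(0 <= k < n) (s ^+ k / k`!%:R)%:C * (A ^+ k) i j.
Proof.
rewrite /pseries /series/=; apply/eqP; rewrite eq_complex/= !raddf_sum/=.
apply/andP; split; apply/eqP; apply: eq_bigr => k _.
  by rewrite ReMreal /re_coef; ring.
by rewrite ImMreal /im_coef; ring.
Qed.

(** Complex partial sums, through which algebraic identities between powers of [A] pass to the
    limit. *)
Lemma exp_mx_cvg A (s : R) i j :
  is_ccvg (fun n => \sum_(0 <= k < n) (s ^+ k / k`!%:R)%:C * (A ^+ k) i j)
    (exp_mx (s%:C *: A) i j).
Proof.
rewrite exp_mxE; under eq_fun do rewrite -pseriesE; split => /=.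
  exact: is_cvg_pseries_exp (re_coef_bound A i j) _.
exact: is_cvg_pseries_exp (im_coef_bound A i j) _.
Qed.

Lemma is_mxderive_exp_mx A (s : R) :
  is_mxderive (fun t => exp_mx (t%:C *: A)) s (A *m exp_mx (s%:C *: A)).
Proof.
move=> i j; under eq_fun do rewrite exp_mxE.
(* The series of s^k A^(k+1) / k! is read in two ways: as [A] times the exponential series, and
   below as the formal derivative of that series. *)
have h : is_ccvg (fun n => \sum_(0 <= k < n) (s ^+ k / k`!%:R)%:C * (A ^+ k.+1) i j)
    ((A *m exp_mx (s%:C *: A)) i j).
  rewrite mxE; have /is_ccvg_sum := fun l => is_ccvgMl (A i l) (exp_mx_cvg A s l j).
  rewrite [X in is_ccvg X](_ : _ =
    (fun n => \sum_(0 <= k < n) (s ^+ k / k`!%:R)%:C * (A ^+ k.+1) i j))//.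
  apply/funext => n; under eq_bigr do rewrite mulr_sumr.
  rewrite exchange_big/=; apply: eq_bigr => k _; rewrite exprS mxE mulr_sumr.
  by apply: eq_bigr => l _; rewrite mulrCA.
split => /=.
  rewrite -(cvg_lim _ h.1)//; apply: is_derive_eq.
    exact: (is_derive_exp_pseries s (re_coef_bound A i j)).
  congr (lim (_ @ \oo)); apply/funext => n; rewrite raddf_sum/=.
  apply: eq_bigr => k _.
  by rewrite /= [pseries_diffs _ _]natrM_divf_fact ReMreal; ring.
rewrite -(cvg_lim _ h.2)//; apply: is_derive_eq.
  exact: (is_derive_exp_pseries s (im_coef_bound A i j)).
congr (lim (_ @ \oo)); apply/funext => n; rewrite raddf_sum/=.
apply: eq_bigr => k _.
by rewrite /= [pseries_diffs _ _]natrM_divf_fact ImMreal; ring.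
Qed.

End MatrixExponential.

(** * Linear differential equations and real powers with matrix exponent *)

Section MatrixPower.
Variables (R : realType) (N : nat).
Local Open Scope classical_set_scope.
Implicit Types A B M : 'M[R[i]]_N.

Lemma is_ccvg_unique (u : nat -> R[i]) a b : is_ccvg u a -> is_ccvg u b -> a = b.
Proof.
move=> [ar ai] [br bi]; apply/eqP; rewrite eq_complex; apply/andP; split; apply/eqP.
  exact: (cvg_unique _ ar br).
exact: (cvg_unique _ ai bi).
Qed.

Lemma exp_mx_scale0 A : exp_mx (0%:C *: A) = 1%:M.
Proof.
apply/matrixP => i j; apply: is_ccvg_unique (exp_mx_cvg A 0 i j) _.
(* Only the term k = 0 survives. The empty partial sum is 0 and not the identity, hence the shift of
   the index by one. *)
have E n : \sum_(0 <= k < n.+1) ((0 : R) ^+ k / k`!%:R)%:C * (A ^+ k) i j =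
    (1%:M : 'M[R[i]]_N) i j.
  rewrite big_nat_recl// big1 ?addr0; last first.
    by move=> k _; rewrite expr0n/= mul0r mul0r.
  by rewrite !expr0 divr1 mul1r.
by split; rewrite -cvg_shiftS; under eq_fun do rewrite E; exact: cvg_cst.
Qed.

Lemma comm_mxX A B k : comm_mx B A -> comm_mx B (A ^+ k).
Proof.
rewrite /comm_mx => BA; elim: k => [|k ih]; first by rewrite !expr0 mulmx1 mul1mx.
rewrite !exprS; transitivity (B *m (A *m A ^+ k)) => //.
by rewrite mulmxA BA -mulmxA ih mulmxA.
Qed.

(** [B] commutes with every partial sum of the exponential series; uniqueness of limits
    concludes. *)
Lemma comm_mx_exp_mx A B (s : R) : comm_mx B A -> comm_mx B (exp_mx (s%:C *: A)).
Proof.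
rewrite /comm_mx => BA; apply/matrixP => i j; rewrite !mxE.
have h1 := is_ccvg_sum (fun l => is_ccvgMl (B i l) (exp_mx_cvg A s l j)).
have h2 := is_ccvg_sum (fun l => is_ccvgMl (B l j) (exp_mx_cvg A s i l)).
under [RHS]eq_bigr do rewrite mulrC.
apply: is_ccvg_unique h1 _.
rewrite [X in is_ccvg X](_ : _ = fun n =>
    \sum_l B l j * \sum_(0 <= k < n) (s ^+ k / k`!%:R)%:C * (A ^+ k) i l)//.
apply/funext => n.
under eq_bigr do rewrite mulr_sumr.
under [RHS]eq_bigr do rewrite mulr_sumr.
rewrite exchange_big/= [RHS]exchange_big/=; apply: eq_bigr => k _.
under eq_bigr do rewrite mulrCA.
rewrite -mulr_sumr; under [RHS]eq_bigr do rewrite mulrCA [B _ j * _]mulrC.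
rewrite -mulr_sumr; congr (_ * _).
by have /matrixP/(_ i j) := comm_mxX k BA; rewrite !mxE.
Qed.

(** The product has derivative 0 and equals the identity at s = 0, which avoids multiplying the two
    series. *)
Lemma exp_mxNK A (s : R) : exp_mx (s%:C *: (- A)) *m exp_mx (s%:C *: A) = 1%:M.
Proof.
pose F s : 'M[R[i]]_N := exp_mx (s%:C *: (- A)) *m exp_mx (s%:C *: A).
have F0 : F 0 = 1%:M by rewrite /F !exp_mx_scale0 mulmx1.
rewrite -/(F s) -F0; apply: is_mxderive0_cst => {F0}s.
have := is_mxderiveM (is_mxderive_exp_mx (- A) s) (is_mxderive_exp_mx A s).
move=> /is_mxderive_eq; apply.
have -> : (- A) *m exp_mx (s%:C *: (- A)) = exp_mx (s%:C *: (- A)) *m (- A).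
  exact: comm_mx_exp_mx.
by rewrite mulmxN mulNmx -!mulmxA addNr.
Qed.

(** The function exp(-sA) Y(s) has derivative 0, hence keeps its value Y(0). *)
Lemma linear_ode_unique A n (Y : R -> 'M[R[i]]_(N, n)) :
  (forall s, is_mxderive Y s (A *m Y s)) ->
  forall s, Y s = exp_mx (s%:C *: A) *m Y 0.
Proof.
move=> dY s; pose W s : 'M[R[i]]_(N, n) := exp_mx (s%:C *: (- A)) *m Y s.
have W0 : W 0 = Y 0 by rewrite /W exp_mx_scale0 mul1mx.
have -> : Y 0 = W s.
  rewrite -W0; apply: is_mxderive0_cst => {W0}{}s.
  have := is_mxderiveM (is_mxderive_exp_mx (- A) s) (dY s).
  move=> /is_mxderive_eq; apply.
  have -> : (- A) *m exp_mx (s%:C *: (- A)) = exp_mx (s%:C *: (- A)) *m (- A).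
    exact: comm_mx_exp_mx.
  by rewrite mulmxN mulNmx -!mulmxA addNr.
by rewrite /W mulmxA -{1}(opprK A) exp_mxNK mul1mx.
Qed.

(** By uniqueness for linear equations: e^s exp(sA) solves Y' = (A + I) Y with Y(0) = I. *)
Lemma exp_mxD1 A (s : R) :
  exp_mx (s%:C *: (A + 1%:M)) = (expR s)%:C *: exp_mx (s%:C *: A).
Proof.
pose F s : 'M[R[i]]_N := (expR s)%:C *: exp_mx (s%:C *: A).
have dF t : is_mxderive F t ((A + 1%:M) *m F t).
  have hexp : is_cderive (fun s => (expR s)%:C) t (expR t)%:C.
    by apply: is_cderive_real; exact: is_derive_expR.
  apply: is_mxderive_eq (is_mxderiveZ hexp (is_mxderive_exp_mx A t)) _.
  by rewrite mulmxDl mul1mx -scalemxAr addrC.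
rewrite -/(F s) (linear_ode_unique dF) /F expR0 exp_mx_scale0.
by rewrite rmorph1 scale1r mulmx1.
Qed.

Lemma is_mxderive_rpow_mx M (t : R) : 0 < t ->
  is_mxderive (fun u => rpow_mx u M) t (t^-1%:C *: (M *m rpow_mx t M)).
Proof.
move=> t0; have := is_derive1_ln t0; move: (is_mxderive_exp_mx M (ln t)).
exact: is_mxderive_comp.
Qed.

Lemma rpow_mxD1 M (t : R) : 0 < t -> rpow_mx t (M + 1%:M) = t%:C *: rpow_mx t M.
Proof. by move=> t0; rewrite /rpow_mx exp_mxD1 lnK. Qed.

Lemma rpow_mxB1 M (t : R) : 0 < t -> rpow_mx t (M - 1%:M) = t^-1%:C *: rpow_mx t M.
Proof.
move=> t0; rewrite -{2}(subrK 1%:M M) rpow_mxD1// scalerA -rmorphM mulVf ?gt_eqF//.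
by rewrite rmorph1 scale1r.
Qed.

Lemma comm_rpow_mx M B (t : R) : comm_mx B M -> comm_mx B (rpow_mx t M).
Proof. exact: comm_mx_exp_mx. Qed.

End MatrixPower.

(** * Decay of the matrix exponential *)

Section ExponentialDecay.
Variable R : realType.
Local Open Scope classical_set_scope.

Lemma is_derive_ndecrNy (f df : R -> R) (b : R) :
  (forall s : R, is_derive s 1 f (df s)) -> (forall s : R, s <= b -> 0 <= df s) ->
  forall s, s <= b -> f s <= f b.
Proof.
move=> dfE df0 s sb.
apply: (@ger0_derive1_ndecrNy _ f b) => //.
- by move=> t; rewrite in_itv/= => tb; rewrite derive1E derive_val df0// ltW.
- apply: continuous_subspaceT => t.
  exact/differentiable_continuous/derivable1_diffP.
Qed.

Lemma is_derive_expRM (a s : R) :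
  is_derive s 1 (fun t => expR (a * t)) (a * expR (a * s)).
Proof.
have h : is_derive s 1 (fun t => a * t) a.
  by apply: is_derive_eq; rewrite /GRing.scale/= mulr1.
by rewrite mulrC; exact: (is_derive1_comp (is_derive_expR _) h).
Qed.

(* Energy estimate: [h = e^(-2ds) |y|^2] satisfies [h' >= a h - C^2/a] for
   [s <= 0], where [a = Re l - d > 0], so that [e^(-as) (h - C^2/a^2)] is
   nondecreasing and [h] stays bounded as [s -> -oo]. *)
Lemma scalar_ode_decay (y z : R -> R[i]) (l : R[i]) (C d : R) :
  (forall s, is_cderive y s (l * y s + z s)) ->
  d < complex.Re l ->
  (forall s : R, s <= 0 -> taxicab (z s) <= C * expR (d * s)) ->
  exists K, forall s : R, s <= 0 -> taxicab (y s) <= K * expR (d * s).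
Proof.
move=> dy dl zC.
pose p s := complex.Re (y s); pose q s := complex.Im (y s).
pose u s := complex.Re (z s); pose v s := complex.Im (z s).
pose al := complex.Re l; pose be := complex.Im l.
have dp (s : R) : is_derive s 1 p (al * p s - be * q s + u s).
  by have [+ _] := dy s; rewrite raddfD/= ReM.
have dq (s : R) : is_derive s 1 q (al * q s + be * p s + v s).
  by have [_ +] := dy s; rewrite raddfD/= ImM.
pose a := al - d; have a0 : 0 < a by rewrite subr_gt0.
pose D := (C / a) ^+ 2.
pose W s := expR (- a * s) * (expR (- (2 * d) * s) * (p s ^+ 2 + q s ^+ 2) - D).
pose W' s := expR (- a * s) * (expR (- (2 * d) * s) *
    (a * (p s ^+ 2 + q s ^+ 2) + 2 * (p s * u s + q s * v s)) + a * D).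
have dW (s : R) : is_derive s 1 W (W' s).
  have := is_derive_expRM (- a) s; have := is_derive_expRM (- (2 * d)) s.
  move=> h1 h2; apply: is_derive_eq.
  by rewrite /W' /GRing.scale/= /a; ring.
have E1 s : expR (- (2 * d) * s) * expR (d * s) ^+ 2 = 1.
  by rewrite -expRM_natl -expRD -[RHS]expR0; congr expR; ring.
have W'0 s : s <= 0 -> 0 <= W' s.
  move=> s0; rewrite mulr_ge0 ?expR_ge0//.
  have uv : u s ^+ 2 + v s ^+ 2 <= (C * expR (d * s)) ^+ 2.
    apply: le_trans (_ : taxicab (z s) ^+ 2 <= _); last first.
      by rewrite lerXn2r ?nnegrE ?taxicab_ge0 ?zC// (le_trans (taxicab_ge0 (z s)))// zC.
    rewrite /taxicab -/(u s) -/(v s) sqrrD !real_normK ?num_real//.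
    by rewrite addrAC lerDl mulrn_wge0// mulr_ge0.
  have E0 := expR_gt0 (- (2 * d) * s).
  move: (expR (- (2 * d) * s)) (expR (d * s)) (E1 s) E0 uv => e f ef1 E0 uv.
  (* Completing the square: [a] times the difference of the two sides is (ap + u)^2 + (aq + v)^2. *)
  have step : - (u s ^+ 2 + v s ^+ 2) / a <=
      a * (p s ^+ 2 + q s ^+ 2) + 2 * (p s * u s + q s * v s).
    rewrite ler_pdivrMr// -subr_ge0.
    rewrite [leRHS](_ : _ = (a * p s + u s) ^+ 2 + (a * q s + v s) ^+ 2); last ring.
    by rewrite addr_ge0// sqr_ge0.
  have : e * (- (C * f) ^+ 2 / a) <=
      e * (a * (p s ^+ 2 + q s ^+ 2) + 2 * (p s * u s + q s * v s)).
    rewrite ler_wpM2l ?(ltW E0)// (le_trans _ step)//.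
    by rewrite ler_wpM2r ?invr_ge0 ?(ltW a0)// lerN2.
  have -> : e * (- (C * f) ^+ 2 / a) = - (a * D).
    transitivity (- (e * f ^+ 2) * (C ^+ 2 / a)); first by field; rewrite gt_eqF.
    by rewrite ef1 /D; field; rewrite gt_eqF.
  by rewrite -subr_ge0 opprK.
have Wle s : s <= 0 -> W s <= W 0 by move=> s0; exact: is_derive_ndecrNy dW W'0 s s0.
pose B := D + (p 0 ^+ 2 + q 0 ^+ 2).
have D0 : 0 <= D by exact: sqr_ge0.
have B0 : 0 <= B by rewrite addr_ge0// addr_ge0// sqr_ge0.
(* Multiplying W(s) <= W(0) by e^(as) <= 1 gives h(s) <= D + e^(as) (h(0) - D) <= D + h(0) = B. *)
have VB s : s <= 0 -> p s ^+ 2 + q s ^+ 2 <= B * expR (d * s) ^+ 2.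
  move=> s0; have := Wle s s0; rewrite /W !mulr0 expR0 !mul1r => h.
  have e1 : expR (a * s) <= 1 by rewrite expR_le1 pmulr_rle0.
  have : expR (- (2 * d) * s) * (p s ^+ 2 + q s ^+ 2) <= B.
    have := ler_wpM2l (expR_ge0 (a * s)) h.
    rewrite mulrA -expRD mulNr subrr expR0 mul1r lerBlDr => /le_trans; apply.
    rewrite /B addrC lerD2l.
    have V0 : 0 <= p 0 ^+ 2 + q 0 ^+ 2 by rewrite addr_ge0// sqr_ge0.
    rewrite mulrBr lerBlDr (le_trans (ler_piMl V0 e1))// lerDl.
    by rewrite mulr_ge0// expR_ge0.
  move=> /(ler_wpM2r (sqr_ge0 (expR (d * s)))); apply: le_trans.
  by rewrite mulrAC E1 mul1r.
(* Each of |p| and |q| is at most (B + 1) e^(ds), because B <= (B + 1)^2; no square root is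
   taken. *)
exists (2 * (B + 1)) => s s0; rewrite -mulrA mulr_natl mulr2n lerD//.
  rewrite -(@ler_pXn2r _ 2)// ?nnegrE//; last first.
    by rewrite mulr_ge0 ?expR_ge0// addr_ge0.
  rewrite real_normK ?num_real// exprMn.
  apply: le_trans (_ : B * expR (d * s) ^+ 2 <= _).
    by rewrite (le_trans _ (VB s s0))// lerDl sqr_ge0.
  by rewrite ler_wpM2r ?sqr_ge0//; nra.
rewrite -(@ler_pXn2r _ 2)// ?nnegrE//; last first.
  by rewrite mulr_ge0 ?expR_ge0// addr_ge0.
rewrite real_normK ?num_real// exprMn.
apply: le_trans (_ : B * expR (d * s) ^+ 2 <= _).
  by rewrite (le_trans _ (VB s s0))// lerDr sqr_ge0.
by rewrite ler_wpM2r ?sqr_ge0//; nra.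
Qed.

Lemma finite_uniform_bound (I : finType) (P : I -> R -> Prop) :
  (forall i, exists K, P i K) -> (forall i K K', K <= K' -> P i K -> P i K') ->
  exists K, forall i, P i K.
Proof.
move=> /choice[f Pf] mono; exists (\big[Order.max/0]_i f i) => i.
by apply: mono (Pf i); exact: le_bigmax.
Qed.

Lemma mx_uniform_bound m n (F : R -> 'M[R[i]]_(m, n)) (D : set R) (g : R -> R) :
  (forall s, 0 <= g s) ->
  (forall i j, exists K, forall s, D s -> taxicab (F s i j) <= K * g s) ->
  exists K, forall i j s, D s -> taxicab (F s i j) <= K * g s.
Proof.
move=> g0 h.
have mono i j K K' : K <= K' -> (forall s, D s -> taxicab (F s i j) <= K * g s) ->
    forall s, D s -> taxicab (F s i j) <= K' * g s.
  by move=> KK' h' s Ds; rewrite (le_trans (h' s Ds))// ler_wpM2r.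
have := @finite_uniform_bound ('I_m * 'I_n)%type
  (fun ij K => forall s, D s -> taxicab (F s ij.1 ij.2) <= K * g s).
case=> [[i j]/=|[i j]/=|K hK]; [exact: h|exact: mono|].
by exists K => i j; exact: (hK (i, j)).
Qed.

(** Induction on the list of roots. Z = (A - r) Y solves the same equation and is killed by the
    remaining factors, so it decays; the entries of [Y] then satisfy y' = r y + z. When no factor is
    left, Y = 0. *)
Lemma linear_ode_decay N (A : 'M[R[i]]_N.+1) n (d : R) (rs : seq R[i])
    (Y : R -> 'M[R[i]]_(N.+1, n)) :
  (forall r, r \in rs -> d < complex.Re r) ->
  (forall s, is_mxderive Y s (A *m Y s)) ->
  (forall s, horner_mx A (\prod_(r <- rs) ('X - r%:P)) *m Y s = 0) ->
  exists K, forall i j s, s <= 0 -> taxicab (Y s i j) <= K * expR (d * s).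
Proof.
elim: rs Y => [|r rs ih] Y rsd dY Y0.
  exists 0 => i j s _; have := Y0 s; rewrite big_nil rmorph1 mul1mx => ->.
  by rewrite mxE /taxicab/= normr0 addr0 mul0r.
pose Z s := (A - r%:M) *m Y s.
have dZ s : is_mxderive Z s (A *m Z s).
  apply: is_mxderive_eq (is_mxderiveMl _ (dY s)) _.
  rewrite /Z !mulmxA; congr (_ *m _).
  by rewrite mulmxBl mulmxBr scalar_mxC.
have [||K hK] := ih Z _ dZ.
- by move=> r' r'rs; apply: rsd; rewrite inE r'rs orbT.
- move=> s; rewrite /Z mulmxA -[RHS](Y0 s) big_cons mulrC rmorphM/=.
  by rewrite rmorphB/= horner_mx_X horner_mx_C.
apply: (@mx_uniform_bound _ _ Y [set s | s <= 0]) => [s|i j]; first exact: expR_ge0.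
apply: (@scalar_ode_decay (fun s => Y s i j) (fun s => Z s i j) r K d).
- move=> s; have := dY s i j; congr is_cderive.
  rewrite /Z mulmxBl mul_scalar_mx [in RHS]mxE [X in _ + (_ + X)]mxE.
  by rewrite [X in _ + (_ - X)]mxE addrC subrK.
- by apply: rsd; rewrite mem_head.
- by move=> s s0; exact: hK.
Qed.

(** Finitely many strict inequalities leave a margin. It makes the decay rate strictly larger than
    [c], in particular positive for c = 0. *)
Lemma seq_Re_gt_separation (rs : seq R[i]) (c : R) :
  (forall r, r \in rs -> c < complex.Re r) ->
  exists2 d, c < d & forall r, r \in rs -> d < complex.Re r.
Proof.
elim: rs => [|r rs ih] rsc; first by exists (c + 1) => //; rewrite ltrDl.
have [|d cd dP] := ih; first by move=> r' h; apply: rsc; rewrite inE h orbT.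
have cr : c < complex.Re r by apply: rsc; rewrite mem_head.
exists (Order.min d ((c + complex.Re r) / 2)).
  by rewrite lt_min cd/=; lra.
move=> r'; rewrite inE => /predU1P[->|/dP dr']; rewrite gt_min ?dr'//.
by apply/orP; right; lra.
Qed.

Lemma char_poly_split N (A : 'M[R[i]]_N) :
  {rs : seq R[i] | char_poly A = \prod_(r <- rs) ('X - r%:P)}.
Proof.
have [rs] := closed_field_poly_normal (char_poly A).
by rewrite (monicP (char_poly_monic A)) scale1r => rsE; exists rs.
Qed.

Lemma eigenvalues_Re_gt_exists N (A : 'M[R[i]]_N) :
  exists c, eigenvalues_Re_gt A c.
Proof.
have [rs rsE] := char_poly_split A.
(* Each root satisfies Re r >= -|Re r|, and the sum contains |Re r|. *)
exists (- (1 + \sum_(r <- rs) `|complex.Re r|)) => a.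
rewrite eigenvalue_root_char rsE root_prod_XsubC => ars.
rewrite ltrNl (le_lt_trans (ler_norm _))// normrN (big_rem a)//=.
rewrite addrCA ltrDl ltr_wpDr//; exact: sumr_ge0.
Qed.

(** The characteristic polynomial splits over the complex numbers and annihilates [A] by
    Cayley-Hamilton, so its linear factors can be peeled off the solution exp(sA). *)
Lemma exp_mx_decay N (A : 'M[R[i]]_N) (c : R) : eigenvalues_Re_gt A c ->
  exists d K : R, c < d /\ forall i j s, s <= 0 ->
    taxicab (exp_mx (s%:C *: A) i j) <= K * expR (d * s).
Proof.
(* A matrix of size 0 has no entries, so any d > c will do. *)
case: N A => [A _|N A hA]; first by exists (c + 1), 0; rewrite ltrDl; split=> // -[].
have [rs rsE] := char_poly_split A.
have rsc r : r \in rs -> c < complex.Re r.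
  move=> rrs; apply: hA; rewrite eigenvalue_root_char rsE.
  by rewrite root_prod_XsubC.
have [d cd dP] := seq_Re_gt_separation rsc.
have [|s|K hK] := @linear_ode_decay _ A _ d rs (fun s => exp_mx (s%:C *: A)) dP.
- exact: is_mxderive_exp_mx.
- by rewrite -rsE Cayley_Hamilton mul0mx.
- by exists d, K.
Qed.

(** For s <= 0 the decay bound of [A] is used with any lower bound on its spectrum; for s > 0 the
    same is applied to -A at -s. *)
Lemma exp_mx_growth N (A : 'M[R[i]]_N) :
  exists c K : R, [/\ 0 < c, 0 <= K & forall i j s,
    taxicab (exp_mx (s%:C *: A) i j) <= K * expR (c * `|s|)].
Proof.
have half (B : 'M[R[i]]_N) : exists c K : R, [/\ 0 < c, 0 <= K & forall i j s,
    s <= 0 -> taxicab (exp_mx (s%:C *: B) i j) <= K * expR (c * `|s|)].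
  have [c0 /exp_mx_decay[d [K [_ hK]]]] := eigenvalues_Re_gt_exists B.
  (* The added 1 makes the rate positive; its inverse is needed when the kernel is estimated at
     infinity. *)
  exists (`|d| + 1), `|K|; split => // i j s s0.
  apply: (le_trans (hK i j s s0)).
  apply: (le_trans (ler_wpM2r (expR_ge0 _) (ler_norm K))).
  rewrite ler_wpM2l// ler_expR (le_trans (ler_norm _))// normrM ler_wpM2r//.
  by rewrite lerDl.
have [c1 [K1 [c10 K10 h1]]] := half A.
have [c2 [K2 [c20 K20 h2]]] := half (- A).
exists (c1 + c2), (K1 + K2); split; [exact: addr_gt0|exact: addr_ge0|].
move=> i j s; have [s0|s0] := leP s 0.
  apply: (le_trans (h1 i j s s0)); apply: ler_pM => //.
    by rewrite lerDl.
  by rewrite ler_expR ler_wpM2r// lerDl ltW.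
rewrite -[A]opprK scalerN -scaleNr -rmorphN.
have sN0 : - s <= 0 by rewrite oppr_le0 ltW.
apply: (le_trans (h2 i j _ sN0)); rewrite normrN.
apply: ler_pM => //.
  by rewrite lerDr.
by rewrite ler_expR ler_wpM2r// lerDr ltW.
Qed.

End ExponentialDecay.

(** * Improper integrals *)

Section ImproperIntegral.
Variable R : realType.
Local Open Scope classical_set_scope.
Local Notation mu := (@lebesgue_measure R).

Lemma derive1_is_derive (f : R -> R) (x l : R) :
  derivable f x 1 /\ f^`() x = l -> is_derive x 1 f l.
Proof. by move=> [df <-]; rewrite derive1E; exact: derivableP. Qed.

Lemma is_derive_continuous (f : R -> R) (x df : R) :
  is_derive x 1 f df -> {for x, continuous f}.
Proof.
move=> [dfx _].
exact/differentiable_continuous/derivable1_diffP.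
Qed.

Lemma measurable_fun_itv_pos (f : R -> R) (D : set R) :
  (forall t : R, 0 < t -> {for t, continuous f}) -> measurable D ->
  D `<=` [set t : R | 0 < t] -> measurable_fun D f.
Proof.
move=> cf mD Dpos; have h : measurable_fun (`]0, +oo[%classic : set R) f.
  apply: open_continuous_measurable_fun => //.
  by move=> t; rewrite inE/= in_itv/= andbT => t0; exact: cf.
apply: measurable_funS h => //.
by move=> t /Dpos/=; rewrite in_itv/= andbT.
Qed.

(** Monotone convergence along segments that exhaust [D], with the fundamental theorem of calculus
    on each. Either endpoint may move, which covers integrals up to infinity and down to 0. *)
Lemma exhaustion_integral_le (g G : R -> R) (a b : nat -> R) (D : set R) (L : R) :
  (forall n, 0 < a n) -> (forall n, a n < b n) ->
  nonincreasing_seq a -> nondecreasing_seq b ->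
  D = \bigcup_n `[a n, b n]%classic ->
  (forall t : R, 0 < t -> is_derive t 1 G (g t)) ->
  (forall t : R, 0 < t -> {for t, continuous g}) ->
  (forall t : R, 0 < t -> 0 <= g t) ->
  (forall n, G (b n) - G (a n) <= L) ->
  (\int[mu]_(t in D) (g t)%:E <= L%:E)%E.
Proof.
move=> a0 ab na nb DE dG cg g0 GL.
have sub0 n : `[a n, b n]%classic `<=` [set t : R | 0 < t].
  by move=> t /=; rewrite in_itv/= => /andP[+ _]; exact: lt_le_trans.
have intn n : (\int[mu]_(t in `[a n, b n]) (g t)%:E = (G (b n) - G (a n))%:E)%E.
  rewrite (@continuous_FTC2 _ _ G)//.
  - apply: continuous_in_subspaceT => t; rewrite inE => /sub0; exact: cg.
  - split.
    + move=> t; rewrite in_itv/= => /andP[at_ _].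
      by have [] := dG t (lt_trans (a0 n) at_).
    + apply: cvg_at_right_filter; apply: is_derive_continuous; exact: dG.
    + apply: cvg_at_left_filter; apply: is_derive_continuous; apply: dG.
      exact: lt_trans (ab n).
  - move=> t; rewrite in_itv/= => /andP[at_ _].
    have dGt := dG t (lt_trans (a0 n) at_).
    by rewrite derive1E derive_val.
have mF n : measurable (`[a n, b n]%classic : set R) by [].
have mf n : measurable_fun (`[a n, b n]%classic : set R) (EFin \o g).
  by apply/measurable_EFinP; apply: measurable_fun_itv_pos.
have nd : nondecreasing_seq (fun n => `[a n, b n]%classic : set R).
  move=> m n mn; rewrite subsetEset; apply: subset_itv; rewrite bnd_simp.
    exact: na.
  exact: nb.
have h1 i x : `[a i, b i]%classic x -> (0 <= (EFin \o g) x)%E.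
  by move=> /sub0 x0; rewrite lee_fin g0.
have h := ge0_nondecreasing_set_cvg_integral (mu := mu) nd mF mf h1.
rewrite DE -(cvg_lim _ h)//; apply: lime_le; first by apply/cvg_ex; eexists; exact: h.
by apply: nearW => n; rewrite intn lee_fin.
Qed.

Lemma dominated_integrable (f g : R -> R) (D : set R) (K L : R) :
  measurable D -> D `<=` [set t : R | 0 < t] ->
  (forall t : R, 0 < t -> {for t, continuous f}) ->
  (forall t : R, 0 < t -> {for t, continuous g}) ->
  (forall t : R, 0 < t -> 0 <= g t) ->
  (forall t, D t -> `|f t| <= K * g t) ->
  (\int[mu]_(t in D) (g t)%:E <= L%:E)%E ->
  mu.-integrable D (EFin \o f) /\
  `|(\int[mu]_(t in D) f t)%R| <= `|K| * L.
Proof.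
move=> mD Dpos cf cg g0 fg gL.
have ig : mu.-integrable D (EFin \o g).
  apply/integrableP; split.
    by apply/measurable_EFinP; exact: measurable_fun_itv_pos.
  apply: le_lt_trans (ltry L); apply: le_trans gL.
  rewrite le_eqVlt; apply/orP; left; apply/eqP; apply: eq_integral.
  by move=> t; rewrite inE => /Dpos t0; rewrite gee0_abs// lee_fin g0.
have iKg : mu.-integrable D (EFin \o (fun t => `|K| * g t)).
  have := @integrableZl _ _ _ mu D mD `|K| _ ig.
  by apply: eq_integrable.
(* [K] carries no sign; with |K| the majorant is nonnegative. *)
have fKg t : D t -> `|f t| <= `|K| * g t.
  move=> Dt; rewrite (le_trans (fg t Dt))// ler_wpM2r ?ler_norm// g0//.
  exact: Dpos.
have if_ : mu.-integrable D (EFin \o f).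
  apply: le_integrable iKg => //.
    by apply/measurable_EFinP; exact: measurable_fun_itv_pos.
  by move=> t Dt /=; rewrite lee_fin (le_trans (fKg t Dt))// ler_norm.
split => //; apply: le_trans; first exact: le_normr_Rintegral.
apply: (@le_trans _ _ (\int[mu]_(t in D) (`|K| * g t))%R).
  apply: le_Rintegral => //.
  have := integrable_abse if_; apply: eq_integrable => //.
rewrite RintegralZl// ler_wpM2l//.
rewrite -lee_fin (le_trans _ gL)// /Rintegral fineK//.
exact: integrable_fin_num.
Qed.

Lemma is_derive_Rintegral_lower (f : R -> R) (x u : R) : 0 < x -> x < u ->
  mu.-integrable `]0, u] (EFin \o f) -> {for x, continuous f} ->
  is_derive x 1 (fun y => (\int[mu]_(t in `]0%R, y]) f t)%R) (f x).
Proof.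
move=> x0 xu fi fx.
exact: derive1_is_derive (@continuous_FTC1 _ f (BRight 0) x u xu fi x0 fx).
Qed.

(** Near [x], the integral over [y, +oo[ is a constant minus the integral over [a, y], which the
    fundamental theorem of calculus differentiates. *)
Lemma is_derive_Rintegral_upper (f : R -> R) (x a : R) : a < x ->
  mu.-integrable `[a, +oo[ (EFin \o f) -> {for x, continuous f} ->
  is_derive x 1 (fun y => (\int[mu]_(t in `[y, +oo[) f t)%R) (- f x).
Proof.
move=> ax fi fx.
have fi' b c : (BLeft a <= b)%O -> mu.-integrable [set` Interval b c] (EFin \o f).
  move=> ab; apply: integrableS fi => //.
  by apply: subset_itv => //; case: c => [[] ?|[]].
pose F y := (\int[mu]_(t in `[a, y]) f t)%R.
have xx1 : x < x + 1 by rewrite ltrDl.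
have iax : mu.-integrable [set` Interval (BLeft a) (BRight (x + 1))] (EFin \o f).
  exact: fi'.
have dF : is_derive x 1 F (f x).
  exact: derive1_is_derive (@continuous_FTC1 _ f (BLeft a) x (x + 1) xx1 iax ax fx).
pose c : R := (\int[mu]_(t in `[a, +oo[) f t)%R.
apply: (@near_eq_is_derive _ _ _ (fun y => c - F y)).
  near=> y; have ay : a < y by near: y; exact: lt_nbhsr.
  rewrite /c /F Rintegral_itvB//; last by rewrite bnd_simp ltW.
  rewrite Rintegral_itv_obnd_cbnd//; apply: fi'.
  by rewrite bnd_simp ltW.
by rewrite -[- f x]sub0r; exact: is_deriveB (is_derive_cst c x 1) dF.
Unshelve. all: by end_near. Qed.

End ImproperIntegral.

(** * Incomplete gamma matrix functions *)

Section IncompleteGamma.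
Variables (R : realType) (N : nat).
Local Open Scope classical_set_scope.
Local Notation mu := (@lebesgue_measure R).
Implicit Types M : 'M[R[i]]_N.

Lemma eigenvalues_Re_gt_shift M (c r : R) :
  eigenvalues_Re_gt M r -> eigenvalues_Re_gt (M + (c%:C)%:M) (r + c).
Proof.
move=> hM a /eigenvalueP[v vM v0].
have /hM : eigenvalue M (a - c%:C).
  apply/eigenvalueP; exists v => //; rewrite scalerBl -vM mulmxDr.
  by rewrite mul_mx_scalar addrK.
by rewrite raddfB/= ltrBrDr.
Qed.

(** Common integrand of both incomplete gamma functions, which are its [integral_mx] up to
    unfolding. *)
Definition gamma_kernel M (t : R) : 'M[R[i]]_N :=
  (expR (- t))%:C *: rpow_mx t (M - 1%:M).

Definition dominated (D : set R) (F : R -> 'M[R[i]]_N) (g : R -> R) : Prop :=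
  exists K, forall i j t, D t -> taxicab (F t i j) <= K * g t.

Lemma dominatedD D F G g : dominated D F g -> dominated D G g ->
  dominated D (fun t => F t + G t) g.
Proof.
move=> [K hK] [L hL]; exists (K + L) => i j t Dt.
by rewrite mxE (le_trans (taxicabD _ _))// mulrDl lerD ?hK ?hL.
Qed.

Lemma dominatedN D F g : dominated D F g -> dominated D (fun t => - F t) g.
Proof.
move=> [K hK]; exists K => i j t Dt.
by rewrite mxE /taxicab !raddfN !normrN; exact: hK.
Qed.

Lemma dominatedMl D (A : 'M[R[i]]_N) F g : dominated D F g ->
  dominated D (fun t => A *m F t) g.
Proof.
move=> [K hK]; exists (mx_taxicab A * K) => i j t Dt.
apply: (le_trans (taxicab_mulmx _ _ (fun k => hK k j t Dt))).
rewrite -mulrA ler_wpM2r ?row_taxicab_le//.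
exact: le_trans (taxicab_ge0 _) (hK i j t Dt).
Qed.

Lemma is_cderive_expRN (t : R) :
  is_cderive (fun u => (expR (- u))%:C) t (- expR (- t))%:C.
Proof.
apply: is_cderive_real; have := is_derive_expRM (- 1) t; rewrite !mulN1r.
by under eq_fun do rewrite mulN1r.
Qed.

Lemma gamma_kernel_derivable M (t : R) : 0 < t ->
  exists L, is_mxderive (gamma_kernel M) t L.
Proof.
move=> t0; eexists; apply: is_mxderiveZ; first exact: is_cderive_expRN.
exact: is_mxderive_rpow_mx.
Qed.

Lemma gamma_kernel_continuous M i j (t : R) : 0 < t ->
  {for t, continuous (fun u => complex.Re (gamma_kernel M u i j))} /\
  {for t, continuous (fun u => complex.Im (gamma_kernel M u i j))}.
Proof.
move=> /(gamma_kernel_derivable M)[L /(_ i j)[hr hi]].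
by split; [exact: is_derive_continuous hr|exact: is_derive_continuous hi].
Qed.

Lemma expR_half_continuous (t : R) :
  {for t, continuous (fun u : R => expR (- 2^-1 * u))}.
Proof. exact: is_derive_continuous (is_derive_expRM _ _). Qed.

(** This is 1 + ln(et) <= et. The slope [e] may be as small as desired, so a power of [t] costs only
    a fraction of the decay of e^-t. *)
Lemma ln_le_linear (e t : R) : 0 < e -> 0 < t -> ln t <= e * t - ln e.
Proof.
move=> e0 t0; rewrite lerBrDl -lnM ?posrE//.
have et0 : 0 < e * t by exact: mulr_gt0.
have := expR_ge1Dx (ln (e * t)); rewrite lnK ?posrE// => h.
by rewrite (le_trans _ h)// lerDr.
Qed.

(** The power t^(M-I) is bounded by a multiple of e^(c |ln t|), and c |ln t| <= t/2 + const for t >=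
    x; half of the exponent in e^-t remains. *)
Lemma gamma_kernel_dominated_y M (x : R) : 0 < x ->
  dominated `[x, +oo[ (gamma_kernel M) (fun t => expR (- 2^-1 * t)).
Proof.
move=> x0; have [c [K [c0 K0 hK]]] := exp_mx_growth (M - 1%:M).
(* Chosen so that c e = 1/2. *)
pose e := (2 * c)^-1; have e0 : 0 < e by rewrite invr_gt0 mulr_gt0.
exists (K * expR (c * (`|ln e| + `|ln x|))) => i j t /=.
rewrite in_itv/= andbT => xt; have t0 := lt_le_trans x0 xt.
rewrite /gamma_kernel mxE taxicab_real_mul (ger0_norm (expR_ge0 _)).
apply: (le_trans (ler_wpM2l (expR_ge0 _) (hK i j (ln t)))).
rewrite mulrCA -mulrA ler_wpM2l// -!expRD ler_expR.
have lnt : `|ln t| <= e * t + (`|ln e| + `|ln x|).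
  rewrite ler_norml; apply/andP; split.
    rewrite lerNl; apply: (@le_trans _ _ (- ln x)).
      by rewrite lerN2 ler_ln ?posrE.
    rewrite (le_trans (ler_norm _))// normrN addrA lerDr addr_ge0//.
    by rewrite mulr_ge0// ltW.
  apply: (le_trans (ln_le_linear e0 t0)); rewrite lerD2l.
  by rewrite (le_trans (ler_norm _))// normrN lerDl.
have := ler_wpM2l (ltW c0) lnt.
have -> : c * (e * t + (`|ln e| + `|ln x|)) = 2^-1 * t + c * (`|ln e| + `|ln x|).
  by rewrite /e; field; rewrite gt_eqF.
by lra.
Qed.

(** For t <= 1 this is the decay of exp(sM) at s = ln t. For 1 < t <= b the growth bound is at most
    a constant, and t^d >= 1. *)
Lemma rpow_mx_dominated_0 M : eigenvalues_Re_gt M 0 ->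
  exists2 d : R, 0 < d &
    forall b, dominated `]0, b] (fun t => rpow_mx t M) (fun t => expR (d * ln t)).
Proof.
move=> /exp_mx_decay[d [K [d0 hK]]]; exists d => // b.
have [c [L [c0 L0 hL]]] := exp_mx_growth M.
exists (`|K| + L * expR (c * `|ln b|)) => i j t /=.
rewrite in_itv/= => /andP[t0 tb]; have [s0|s0] := leP (ln t) 0.
  apply: (le_trans (hK i j _ s0)); rewrite ler_wpM2r ?expR_ge0//.
  by rewrite (le_trans (ler_norm K))// lerDl mulr_ge0// expR_ge0.
apply: (le_trans (hL i j _)); rewrite mulrDl.
apply: (@le_trans _ _ (L * expR (c * `|ln b|) * expR (d * ln t))); last first.
  by rewrite lerDr mulr_ge0// expR_ge0.
rewrite -mulrA ler_wpM2l// -[leLHS]mulr1; apply: ler_pM; rewrite ?expR_ge0//.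
  rewrite ler_expR ler_wpM2l ?(ltW c0)// gtr0_norm//.
  by rewrite (le_trans _ (ler_norm _))// ler_ln ?posrE// (lt_le_trans t0).
by rewrite -expR0 ler_expR mulr_ge0// ltW.
Qed.

(** The scalar power u^d, written as exp(d ln u) to match [rpow_mx]. *)
Lemma is_derive_pow_ln (d t : R) : 0 < t ->
  is_derive t 1 (fun u : R => expR (d * ln u)) (d * (t^-1 * expR (d * ln t))).
Proof.
move=> t0; have h := is_derive1_comp (is_derive_expRM d (ln t)) (is_derive1_ln t0).
by apply: is_derive_eq h _; ring.
Qed.

Lemma pow_ln_kernel_continuous (d t : R) : 0 < t ->
  {for t, continuous (fun u : R => u^-1 * expR (d * ln u))}.
Proof.
move=> t0; have h := is_derive_pow_ln d t0; apply: cvgM.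
  by apply: cvgV; rewrite ?gt_eqF//; exact: cvg_id.
exact: is_derive_continuous h.
Qed.

Lemma gamma_kernel_dominated_0 M (d b : R) :
  dominated `]0, b] (fun t => rpow_mx t M) (fun t => expR (d * ln t)) ->
  dominated `]0, b] (gamma_kernel M) (fun t => t^-1 * expR (d * ln t)).
Proof.
move=> [K hK]; exists K => i j t Dt; move: (Dt) => /=.
rewrite in_itv/= => /andP[t0 tb].
rewrite /gamma_kernel rpow_mxB1// 2!mxE !taxicab_real_mul.
rewrite (ger0_norm (expR_ge0 _)) ger0_norm ?invr_ge0 ?(ltW t0)//.
rewrite [leRHS]mulrCA; apply: (@le_trans _ _ (t^-1 * taxicab (rpow_mx t M i j))).
  rewrite ler_piMl ?mulr_ge0 ?taxicab_ge0 ?invr_ge0 ?(ltW t0)//.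
  by rewrite expR_le1 oppr_le0 ltW.
by rewrite ler_wpM2l ?hK// invr_ge0 ltW.
Qed.

Lemma expR_half_integral_y (x : R) : 0 < x ->
  (\int[mu]_(t in `[x, +oo[) (expR (- 2^-1 * t))%:E <= (2 * expR (- 2^-1 * x))%:E)%E.
Proof.
move=> x0.
apply: (@exhaustion_integral_le _ _ (fun t => - 2 * expR (- 2^-1 * t))
  (fun=> x) (fun n => x + n.+1%:R)).
- by [].
- by move=> n; rewrite ltrDl.
- by move=> m n _.
- by move=> m n mn; rewrite lerD2l ler_nat.
- apply/seteqP; split => t /=.
    rewrite in_itv/= andbT => xt; exists (Num.truncn (t - x)) => //=.
    rewrite in_itv/= xt/= -lerBlDl ltW//.
    by rewrite truncnS_gt.
  by move=> [n _]/=; rewrite !in_itv/= andbT => /andP[].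
- move=> t t0; have h := is_derive_expRM (- 2^-1 : R) t.
  by apply: is_derive_eq; rewrite /GRing.scale/=; field.
- by move=> t _; exact: expR_half_continuous.
- by move=> t _; exact: expR_ge0.
- move=> n; set e := expR (_ * x); have := expR_ge0 (- 2^-1 * (x + n.+1%:R)).
  by lra.
Qed.

Lemma pow_ln_integral_0 (d x : R) : 0 < d -> 0 < x ->
  (\int[mu]_(t in `]0%R, x]) (t^-1 * expR (d * ln t))%:E <=
    (d^-1 * expR (d * ln x))%:E)%E.
Proof.
move=> d0 x0.
(* The left endpoints x/(n+2) stay strictly below [x], also for n = 0. *)
apply: (@exhaustion_integral_le _ _ (fun t => d^-1 * expR (d * ln t))
  (fun n => x / n.+2%:R) (fun=> x)).
- by move=> n; rewrite divr_gt0.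
- by move=> n; rewrite gtr_pMr// invf_lt1// ltr1n.
- move=> m n mn; rewrite ler_pM2l// lef_pV2 ?posrE//.
  by rewrite ler_nat.
- by move=> m n _.
- apply/seteqP; split => t /=.
    rewrite in_itv/= => /andP[t0 tx]; exists (Num.truncn (x / t)) => //=.
    rewrite in_itv/= tx andbT ler_pdivrMr// mulrC -ler_pdivrMr// ltW//.
    by apply: (lt_le_trans (truncnS_gt _)); rewrite ler_nat.
  move=> [n _]/=; rewrite !in_itv/= => /andP[h ->]; rewrite andbT.
  by rewrite (lt_le_trans _ h)// divr_gt0.
- move=> t t0; have h := is_derive_pow_ln d t0.
  by apply: is_derive_eq; rewrite /GRing.scale/=; rewrite mulKf// gt_eqF.
- by move=> t; exact: pow_ln_kernel_continuous.
- by move=> t t0; rewrite mulr_ge0 ?expR_ge0// invr_ge0 ltW.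
- move=> n; rewrite gerBl mulr_ge0 ?expR_ge0// invr_ge0 ltW//.
Qed.

End IncompleteGamma.

(** * Estimates, first derivatives and recurrences of the incomplete gamma functions *)

Section IncompleteGammaRecurrence.
Variables (R : realType) (N : nat).
Local Open Scope classical_set_scope.
Local Notation mu := (@lebesgue_measure R).
Implicit Types M : 'M[R[i]]_N.

Lemma integral_mx_dominated M (D : set R) (g : R -> R) (K L : R) :
  measurable D -> D `<=` [set t : R | 0 < t] ->
  (forall t : R, 0 < t -> {for t, continuous g}) ->
  (forall t : R, 0 < t -> 0 <= g t) ->
  (forall i j t, D t -> taxicab (gamma_kernel M t i j) <= K * g t) ->
  (\int[mu]_(t in D) (g t)%:E <= L%:E)%E -> forall i j,
  [/\ mu.-integrable D (EFin \o (fun t => complex.Re (gamma_kernel M t i j))),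
      mu.-integrable D (EFin \o (fun t => complex.Im (gamma_kernel M t i j))) &
      taxicab (integral_mx D (gamma_kernel M) i j) <= 2 * `|K| * L].
Proof.
move=> mD Dpos cg g0 hK gL i j.
have [ire bre] := @dominated_integrable _
  (fun t => complex.Re (gamma_kernel M t i j)) g D K L mD Dpos
  (fun t t0 => (gamma_kernel_continuous M i j t0).1) cg g0
  (fun t Dt => le_trans (Re_le_taxicab _) (hK i j t Dt)) gL.
have [iim bim] := @dominated_integrable _
  (fun t => complex.Im (gamma_kernel M t i j)) g D K L mD Dpos
  (fun t t0 => (gamma_kernel_continuous M i j t0).2) cg g0
  (fun t Dt => le_trans (Im_le_taxicab _) (hK i j t Dt)) gL.
split=> //.
by rewrite /integral_mx mxE /taxicab/= -mulrA mulr_natl mulr2n lerD.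
Qed.

(** The constant is uniform in y >= x, so this gives both convergence of the integral and its decay
    as y -> oo. *)
Lemma upper_gamma_estimate M (x : R) : 0 < x -> exists K, forall i j y, x <= y ->
  [/\ mu.-integrable `[y, +oo[
        (EFin \o (fun t => complex.Re (gamma_kernel M t i j))),
      mu.-integrable `[y, +oo[
        (EFin \o (fun t => complex.Im (gamma_kernel M t i j))) &
      taxicab (upper_gamma_mx M y i j) <= K * expR (- 2^-1 * y)].
Proof.
move=> x0; have [K hK] := gamma_kernel_dominated_y M x0.
exists (2 * `|K| * 2) => i j y xy; have y0 := lt_le_trans x0 xy.
rewrite -[_ * 2 * _]mulrA.
apply: (@integral_mx_dominated M _ _ K _ _ _ _ _ _ (expR_half_integral_y y0)).
- by [].
- by move=> t/=; rewrite in_itv/= andbT; exact: lt_le_trans.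
- by move=> t _; exact: expR_half_continuous.
- by move=> t _; exact: expR_ge0.
- move=> k l t /=; rewrite in_itv/= andbT => yt; apply: hK => /=.
  by rewrite in_itv/= andbT (le_trans xy).
Qed.

(** Stated from a bound on t^M rather than on eigenvalues, so that one exponent [d] can serve both M
    and M + I. It yields convergence at 0 and decay as y -> 0. *)
Lemma lower_gamma_estimate M (d b : R) : 0 < d ->
  dominated `]0, b] (fun t => rpow_mx t M) (fun t => expR (d * ln t)) ->
  exists K, forall i j y, 0 < y -> y <= b ->
  [/\ mu.-integrable `]0, y]
        (EFin \o (fun t => complex.Re (gamma_kernel M t i j))),
      mu.-integrable `]0, y]
        (EFin \o (fun t => complex.Im (gamma_kernel M t i j))) &
      taxicab (lower_gamma_mx M y i j) <= K * expR (d * ln y)].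
Proof.
move=> d0 /gamma_kernel_dominated_0[K hK].
exists (2 * `|K| * d^-1) => i j y y0 yb.
rewrite -[_ * d^-1 * _]mulrA.
apply: (@integral_mx_dominated M _ _ K _ _ _ _ _ _ (pow_ln_integral_0 d0 y0)).
- by [].
- by move=> t/=; rewrite in_itv/= => /andP[].
- by move=> t; exact: pow_ln_kernel_continuous.
- by move=> t t0; rewrite mulr_ge0 ?expR_ge0// invr_ge0 ltW.
- move=> k l t /=; rewrite in_itv/= => /andP[t0 ty]; apply: hK => /=.
  by rewrite in_itv/= t0 (le_trans ty).
Qed.

Lemma is_mxderive_upper_gamma M (x : R) : 0 < x ->
  is_mxderive (upper_gamma_mx M) x (- gamma_kernel M x).
Proof.
move=> x0 i j; have x20 : 0 < x / 2 by rewrite divr_gt0.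
have x2x : x / 2 < x by rewrite gtr_pMr// invf_lt1// ltr1n.
have [K /(_ i j _ (lexx _))[ire iim _]] := upper_gamma_estimate M x20.
have [cre cim] := gamma_kernel_continuous M i j x0.
rewrite mxE /is_cderive !raddfN/=; split.
  under eq_fun do rewrite /upper_gamma_mx /integral_mx mxE/=.
  exact: (is_derive_Rintegral_upper x2x ire cre).
under eq_fun do rewrite /upper_gamma_mx /integral_mx mxE/=.
exact: (is_derive_Rintegral_upper x2x iim cim).
Qed.

Lemma is_mxderive_lower_gamma M (x : R) : eigenvalues_Re_gt M 0 -> 0 < x ->
  is_mxderive (lower_gamma_mx M) x (gamma_kernel M x).
Proof.
move=> /rpow_mx_dominated_0[d d0 dom] x0 i j.
have xx1 : x < x + 1 by rewrite ltrDl.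
have x10 := lt_trans x0 xx1.
have [K /(_ i j _ x10 (lexx _))[ire iim _]] := lower_gamma_estimate d0 (dom (x + 1)).
have [cre cim] := gamma_kernel_continuous M i j x0.
split.
  under eq_fun do rewrite /lower_gamma_mx /integral_mx mxE/=.
  exact: (is_derive_Rintegral_lower x0 xx1 ire cre).
under eq_fun do rewrite /lower_gamma_mx /integral_mx mxE/=.
exact: (is_derive_Rintegral_lower x0 xx1 iim cim).
Qed.

(** The substitution y = e^s carries the half-line to the whole line. *)
Lemma is_mxderive0_cst_pos m n (F : R -> 'M[R[i]]_(m, n)) :
  (forall y : R, 0 < y -> is_mxderive F y 0) ->
  forall x y : R, 0 < x -> 0 < y -> F x = F y.
Proof.
move=> dF x y x0 y0; rewrite -(lnK x0) -(lnK y0).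
apply: (@is_mxderive0_cst _ _ _ (fun s => F (expR s))) => s.
apply: is_mxderive_eq (is_mxderive_comp (dF _ (expR_gt0 s)) (is_derive_expR s)) _.
by rewrite scaler0.
Qed.

Lemma exp_decay_eq0 (A : 'M[R[i]]_N) (K d : R) : 0 < d ->
  (forall i j s, s <= 0 -> taxicab (A i j) <= K * expR (d * s)) -> A = 0.
Proof.
move=> d0 hA; apply/matrixP => i j; rewrite mxE.
have c0 := taxicab_ge0 (A i j).
suff t0 : taxicab (A i j) = 0.
  move: t0; rewrite /taxicab => /eqP; rewrite paddr_eq0// !normr_eq0.
  by move=> /andP[re im]; apply/eqP; rewrite eq_complex re im.
apply/eqP; rewrite eq_le c0 andbT leNgt; apply/negP.
set c := taxicab _ in c0 *; move=> {}c0.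
have K0 : 0 <= K.
  by have := hA i j 0 (lexx _); rewrite mulr0 expR0 mulr1; exact/le_trans/ltW.
(* At s = -x/d the bound reads c e^x <= K, whereas c e^x >= c (1 + x) = c + K > K. *)
pose x := K / c; have x0 : 0 <= x by rewrite divr_ge0// ltW.
have : c <= K * expR (d * (- (x / d))).
  by apply: hA; rewrite oppr_le0 divr_ge0// ltW.
have -> : d * (- (x / d)) = - x by field; rewrite gt_eqF.
rewrite expRN ler_pdivlMr ?expR_gt0// leNgt => /negP; apply.
apply: (@lt_le_trans _ _ (c * (1 + x))); last by rewrite ler_wpM2l ?expR_ge1Dx// ltW.
by rewrite mulrDr mulr1 /x mulrCA mulfV ?gt_eqF// mulr1 ltrDr.
Qed.

(** The boundary term of an integration by parts: its derivative is the combination of the kernels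
    of M and M + I that cancels in both recurrences. *)
Lemma is_mxderive_expRN_rpow M (y : R) : 0 < y ->
  is_mxderive (fun y => (expR (- y))%:C *: rpow_mx y M) y
    (M *m gamma_kernel M y - gamma_kernel (M + 1%:M) y).
Proof.
move=> y0.
apply: is_mxderive_eq (is_mxderiveZ (is_cderive_expRN y) (is_mxderive_rpow_mx M y0)) _.
rewrite /gamma_kernel addrK rpow_mxB1// rmorphN scaleNr addrC.
by rewrite -!scalemxAr.
Qed.

Lemma upper_gamma_mxD1 M (x : R) : 0 < x ->
  upper_gamma_mx (M + 1%:M) x =
  M *m upper_gamma_mx M x + (expR (- x))%:C *: rpow_mx x M.
Proof.
move=> x0.
pose D y := upper_gamma_mx (M + 1%:M) y +
  (- (M *m upper_gamma_mx M y) - (expR (- y))%:C *: rpow_mx y M).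
have dD y : 0 < y -> is_mxderive D y 0.
  move=> y0; have d1 := is_mxderive_upper_gamma (M + 1%:M) y0.
  have d2 := is_mxderiveN (is_mxderiveMl M (is_mxderive_upper_gamma M y0)).
  have d3 := is_mxderiveN (is_mxderive_expRN_rpow M y0).
  apply: is_mxderive_eq (is_mxderiveD d1 (is_mxderiveD d2 d3)) _.
  by rewrite mulmxN opprK opprB [X in - _ + X]addrCA subrr addr0 addNr.
have [K hK] : dominated `[1, +oo[ D (fun t => expR (- 2^-1 * t)).
  have dom M' : dominated `[1, +oo[ (upper_gamma_mx M') (fun t => expR (- 2^-1 * t)).
    have [K hK] := upper_gamma_estimate M' ltr01; exists K => i j t /=.
    by rewrite in_itv/= andbT => /(hK i j)[].
  apply: dominatedD; first exact: dom.
  apply: dominatedD; first exact/dominatedN/dominatedMl/dom.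
  (* The boundary term e^-y y^M is itself the kernel of M + I. *)
  apply: dominatedN; have := gamma_kernel_dominated_y (M + 1%:M) ltr01.
  by rewrite /gamma_kernel addrK.
apply/eqP; rewrite -subr_eq0 opprD; apply/eqP; rewrite -/(D x).
apply: (@exp_decay_eq0 _ (K * expR (- 2^-1)) 2^-1) => [|i j s s0].
  by rewrite invr_gt0.
(* [D] is evaluated at y = 1 - s, which turns its decay as y -> oo into decay as s -> -oo, with
   e^(-y/2) = e^(-1/2) e^(s/2). *)
have s1 : 1 <= 1 - s by rewrite lerBrDr gerDl.
rewrite (@is_mxderive0_cst_pos _ _ D dD x (1 - s))//; last exact: lt_le_trans s1.
have /hK : (`[1, +oo[%classic : set R) (1 - s) by rewrite /= in_itv/= andbT.
move=> /(_ i j); rewrite -mulrA -expRD.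
by congr (_ <= _ * expR _); ring.
Qed.

Lemma lower_gamma_mxD1 M (x : R) : eigenvalues_Re_gt M 0 -> 0 < x ->
  lower_gamma_mx (M + 1%:M) x =
  M *m lower_gamma_mx M x - (expR (- x))%:C *: rpow_mx x M.
Proof.
move=> hM x0.
have hM1 : eigenvalues_Re_gt (M + 1%:M) 0.
  have := eigenvalues_Re_gt_shift (c := 1) hM; rewrite rmorph1 => h a /h.
  by rewrite add0r; exact: lt_trans.
pose D y := lower_gamma_mx (M + 1%:M) y +
  (- (M *m lower_gamma_mx M y) + (expR (- y))%:C *: rpow_mx y M).
have dD y : 0 < y -> is_mxderive D y 0.
  move=> y0; have d1 := is_mxderive_lower_gamma hM1 y0.
  have d2 := is_mxderiveN (is_mxderiveMl M (is_mxderive_lower_gamma hM y0)).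
  have d3 := is_mxderive_expRN_rpow M y0.
  apply: is_mxderive_eq (is_mxderiveD d1 (is_mxderiveD d2 d3)) _.
  by rewrite addKr subrr.
have [d d0 dom] := rpow_mx_dominated_0 hM.
(* Since t^(M+I) = t t^M with t <= b, the exponent [d] of M also works for M + I. *)
have dom1 b : dominated `]0, b] (fun t => rpow_mx t (M + 1%:M))
    (fun t => expR (d * ln t)).
  have [K hK] := dom b; exists (`|b| * K) => i j t Dt; move: (Dt) => /=.
  rewrite in_itv/= => /andP[t0 tb]; rewrite rpow_mxD1// mxE taxicab_real_mul.
  rewrite -mulrA ler_pM ?taxicab_ge0 ?hK// ger0_norm ?(ltW t0)//.
  exact: le_trans tb (ler_norm _).
have [K hK] : dominated `]0, 1] D (fun t => expR (d * ln t)).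
  have est M' : (forall b, dominated `]0, b] (fun t => rpow_mx t M')
      (fun t => expR (d * ln t))) ->
      dominated `]0, 1] (lower_gamma_mx M') (fun t => expR (d * ln t)).
    move=> /(_ 1)/(lower_gamma_estimate d0)[K hK]; exists K => i j t /=.
    by rewrite in_itv/= => /andP[t0 t1]; have [] := hK i j t t0 t1.
  apply: dominatedD; first exact: est.
  apply: dominatedD; first exact/dominatedN/dominatedMl/est.
  have [K hK] := dom 1; exists K => i j t Dt.
  rewrite mxE taxicab_real_mul ger0_norm ?expR_ge0//.
  apply: le_trans (hK i j t Dt); rewrite ler_piMl ?taxicab_ge0// expR_le1.
  by move: Dt; rewrite /= in_itv/= oppr_le0 => /andP[/ltW].
apply/eqP; rewrite -subr_eq0 opprD opprK; apply/eqP; rewrite -/(D x).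
apply: (@exp_decay_eq0 _ K d) => // i j s s0.
(* At y = e^s with s <= 0, the bound y^d becomes e^(ds). *)
rewrite (@is_mxderive0_cst_pos _ _ D dD x (expR s))//; last exact: expR_gt0.
have := hK i j (expR s); rewrite expRK; apply.
by rewrite /= in_itv/= expR_gt0 expR_le1.
Qed.

End IncompleteGammaRecurrence.

(** * Higher derivatives *)

Section HigherDerivatives.
Variables (R : realType) (N : nat).
Local Open Scope classical_set_scope.
Implicit Types P Q M : 'M[R[i]]_N.

Lemma is_mxderive_scale (c : R[i]) m n (F : R -> 'M[R[i]]_(m, n)) (x : R) L :
  is_mxderive F x L -> is_mxderive (fun t => c *: F t) x (c *: L).
Proof.
move=> dF; apply: is_mxderive_eq (is_mxderiveZ (is_cderive_cst c x) dF) _.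
by rewrite scale0r add0r.
Qed.

(** Passes from entrywise derivatives to the derivative in the normed space of real matrices, which
    [nderive_cmx] iterates. *)
Lemma is_mxderive_Re_mx (F : R -> 'M[R[i]]_N) (x : R) L : is_mxderive F x L ->
  derivable (fun t => Re_mx (F t)) x 1 /\ (fun t => Re_mx (F t))^`() x = Re_mx L.
Proof.
move=> dF.
have h i j : is_derive x 1 (fun t => Re_mx (F t) i j) (Re_mx L i j).
  by rewrite mxE; under eq_fun do rewrite mxE; exact: (dF i j).1.
have d : derivable (fun t => Re_mx (F t)) x 1.
  by apply/derivable_mxP => i j; have [] := h i j.
split => //; rewrite derive1E derive_mx//; apply/matrixP => i j.
by rewrite mxE derive_val.
Qed.

Lemma is_mxderive_Im_mx (F : R -> 'M[R[i]]_N) (x : R) L : is_mxderive F x L ->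
  derivable (fun t => Im_mx (F t)) x 1 /\ (fun t => Im_mx (F t))^`() x = Im_mx L.
Proof.
move=> dF.
have h i j : is_derive x 1 (fun t => Im_mx (F t) i j) (Im_mx L i j).
  by rewrite mxE; under eq_fun do rewrite mxE; exact: (dF i j).2.
have d : derivable (fun t => Im_mx (F t)) x 1.
  by apply/derivable_mxP => i j; have [] := h i j.
split => //; rewrite derive1E derive_mx//; apply/matrixP => i j.
by rewrite mxE derive_val.
Qed.

(** Induction on [k]: the k-th derivative agrees with [f k] on the whole half-line, hence near [y],
    so both have the same derivative at [y]. *)
Lemma derive1n_chain (f : nat -> R -> 'M[R]_N) n :
  (forall k y, (k < n)%N -> 0 < y ->
    derivable (f k) y 1 /\ (f k)^`() y = f k.+1 y) ->
  forall k y, (k <= n)%N -> 0 < y -> derive1n k (f 0%N) y = f k y.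
Proof.
move=> df; elim=> [//|k ih] y kn y0.
have near_eq : \forall z \near y, f k z = derive1n k (f 0%N) z.
  near=> z; rewrite ih// ?(ltnW kn)//; near: z; exact: lt_nbhsr.
rewrite derive1nS -(df k y kn y0).2 !derive1E.
by apply: esym; exact: near_eq_derive near_eq.
Unshelve. all: by end_near. Qed.

(** Reduces each formula to one differentiation step between consecutive claimed derivatives. The
    steps are required for k < n only, which the condition Re > n of the fourth formula respects. *)
Lemma nderive_cmx_chain (H : nat -> R -> 'M[R[i]]_N) n :
  (forall k y, (k < n)%N -> 0 < y -> is_mxderive (H k) y (H k.+1 y)) ->
  forall x, 0 < x -> nderivable_cmx n (H 0%N) x /\ nderive_cmx n (H 0%N) x = H n x.
Proof.
move=> dH x x0.
have dre k y kn y0 := is_mxderive_Re_mx (dH k y kn y0).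
have dim k y kn y0 := is_mxderive_Im_mx (dH k y kn y0).
have Ere := @derive1n_chain (fun k z => Re_mx (H k z)) n dre.
have Eim := @derive1n_chain (fun k z => Im_mx (H k z)) n dim.
split; last first.
  rewrite /nderive_cmx Ere// Eim//; apply/matrixP => i j.
  by rewrite !mxE; case: (H n x i j).
rewrite /nderivable_cmx; near=> y => k kn.
have y0 : 0 < y by near: y; exact: lt_nbhsr.
have near_re : \forall z \near y,
    Re_mx (H k z) = derive1n k (fun z => Re_mx (H 0%N z)) z.
  near=> z; rewrite Ere// ?(ltnW kn)//; near: z; exact: lt_nbhsr.
have near_im : \forall z \near y,
    Im_mx (H k z) = derive1n k (fun z => Im_mx (H 0%N z)) z.
  near=> z; rewrite Eim// ?(ltnW kn)//; near: z; exact: lt_nbhsr.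
split.
  exact: near_eq_derivable near_re (dre k y kn y0).1.
exact: near_eq_derivable near_im (dim k y kn y0).1.
Unshelve. all: by end_near. Qed.

(** Product rule with the common factor y^(-P-I) taken out, as y^-P = y y^(-P-I) and [P] commutes
    with its powers. The remaining bracket is the right-hand side of the gamma recurrence when [G]
    is an incomplete gamma function. *)
Lemma is_mxderive_rpow_mul P (G : R -> 'M[R[i]]_N) (y : R) L : 0 < y ->
  is_mxderive G y L ->
  is_mxderive (fun t => rpow_mx t (- P) *m G t) y
    (- (rpow_mx y (- P - 1%:M) *m (P *m G y - y%:C *: L))).
Proof.
move=> y0 dG.
apply: is_mxderive_eq (is_mxderiveM (is_mxderive_rpow_mx (- P) y0) dG) _.
have -> : - P *m rpow_mx y (- P) = rpow_mx y (- P) *m (- P).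
  exact: comm_rpow_mx.
rewrite rpow_mxB1// mulmxBr opprB addrC; congr (_ + _).
  rewrite -scalemxAl -scalemxAr scalerA -rmorphM mulVf ?gt_eqF//.
  by rewrite rmorph1 scale1r.
by rewrite -!scalemxAl mulmxN mulNmx scalerN mulmxA.
Qed.

Lemma is_mxderive_exp_mul M (G1 G0 : R -> 'M[R[i]]_N) (y : R) L :
  is_mxderive G1 y L -> G1 y + L = M *m G0 y ->
  is_mxderive (fun t => (expR t)%:C *: G1 t) y (M *m ((expR y)%:C *: G0 y)).
Proof.
move=> dG E; have de := is_cderive_real (is_derive_expR y).
apply: is_mxderive_eq (is_mxderiveZ de dG) _.
by rewrite -scalerDr E scalemxAr.
Qed.

Lemma scale_gamma_kernel P (y : R) : 0 < y ->
  y%:C *: gamma_kernel P y = (expR (- y))%:C *: rpow_mx y P.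
Proof.
move=> y0; rewrite /gamma_kernel rpow_mxB1// !scalerA -!rmorphM.
by congr (_%:C *: _); field; rewrite gt_eqF.
Qed.

Lemma scalar_mx_natS n : (n.+1%:R)%:M = (n%:R)%:M + 1%:M :> 'M[R[i]]_N.
Proof. by rewrite -natr1 raddfD. Qed.

Lemma pochhammer_mxS M n :
  pochhammer_mx M n.+1 = pochhammer_mx M n *m (M + (n%:R)%:M).
Proof. by rewrite /pochhammer_mx big_ord_recr. Qed.

Lemma eigenvalues_Re_gt_addn Q k : eigenvalues_Re_gt Q 0 ->
  eigenvalues_Re_gt (Q + (k%:R)%:M) 0.
Proof.
move=> hQ; have := eigenvalues_Re_gt_shift (c := k%:R) hQ; rewrite rmorph_nat.
by move=> h a /h; rewrite add0r; apply: le_lt_trans.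
Qed.

Lemma eigenvalues_Re_gt_subn Q n k : (k <= n)%N -> eigenvalues_Re_gt Q n%:R ->
  eigenvalues_Re_gt (Q - (k%:R)%:M) 0.
Proof.
move=> kn hQ; have := eigenvalues_Re_gt_shift (c := - k%:R) hQ.
rewrite rmorphN rmorph_nat raddfN => h a /h; apply: le_lt_trans.
by rewrite subr_ge0 ler_nat.
Qed.

(* [sg] is [-1] for the upper and [1] for the lower incomplete gamma function. *)
Lemma rpow_gamma_step Q (G : 'M[R[i]]_N -> R -> 'M[R[i]]_N) (sg : R[i]) (k : nat)
    (y : R) : 0 < y ->
  is_mxderive (G (Q + (k%:R)%:M)) y (sg *: gamma_kernel (Q + (k%:R)%:M) y) ->
  G (Q + (k%:R)%:M + 1%:M) y = (Q + (k%:R)%:M) *m G (Q + (k%:R)%:M) y -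
    sg *: ((expR (- y))%:C *: rpow_mx y (Q + (k%:R)%:M)) ->
  is_mxderive (fun t => (-1) ^+ k *:
      (rpow_mx t (- Q - (k%:R)%:M) *m G (Q + (k%:R)%:M) t)) y
    ((-1) ^+ k.+1 *:
      (rpow_mx y (- Q - (k.+1%:R)%:M) *m G (Q + (k.+1%:R)%:M) y)).
Proof.
move=> y0; rewrite scalar_mx_natS addrA opprD addrA -opprD.
set P := Q + _ => dG GE.
apply: is_mxderive_eq (is_mxderive_scale _ (is_mxderive_rpow_mul P y0 dG)) _.
(* Here y k(P,y) = e^-y y^P, so the bracket is the recurrence for P + I. *)
rewrite GE [y%:C *: _]scalerA [y%:C * _]mulrC -scalerA scale_gamma_kernel//.
by rewrite exprS mulN1r scaleNr scalerN.
Qed.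

(** The recurrence at Q - (k+1)I says that G + G' at Q - kI is (Q - (k+1)I) G(Q - (k+1)I). The
    factor Q - (k+1)I = -((I - Q) + kI) supplies the next Pochhammer factor and the sign. *)
Lemma exp_gamma_step Q (G : 'M[R[i]]_N -> R -> 'M[R[i]]_N) (sg : R[i]) (k : nat)
    (y : R) : 0 < y ->
  is_mxderive (G (Q - (k%:R)%:M)) y (sg *: gamma_kernel (Q - (k%:R)%:M) y) ->
  G (Q - (k.+1%:R)%:M + 1%:M) y = (Q - (k.+1%:R)%:M) *m G (Q - (k.+1%:R)%:M) y -
    sg *: ((expR (- y))%:C *: rpow_mx y (Q - (k.+1%:R)%:M)) ->
  is_mxderive (fun t => (-1) ^+ k *:
      (pochhammer_mx (1%:M - Q) k *m ((expR t)%:C *: G (Q - (k%:R)%:M) t))) y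
    ((-1) ^+ k.+1 *: (pochhammer_mx (1%:M - Q) k.+1 *m
      ((expR y)%:C *: G (Q - (k.+1%:R)%:M) y))).
Proof.
move=> y0 dG.
have kE : Q - (k%:R)%:M = Q - (k.+1%:R)%:M + 1%:M.
  by rewrite scalar_mx_natS opprD addrA subrK.
rewrite -kE => GE.
have sumE : G (Q - (k%:R)%:M) y + sg *: gamma_kernel (Q - (k%:R)%:M) y =
    (Q - (k.+1%:R)%:M) *m G (Q - (k.+1%:R)%:M) y.
  by rewrite GE /gamma_kernel kE addrK subrK.
have := is_mxderiveMl (pochhammer_mx (1%:M - Q) k) (is_mxderive_exp_mul dG sumE).
move=> /(is_mxderive_scale ((-1) ^+ k))/is_mxderive_eq; apply.
rewrite pochhammer_mxS exprS mulN1r scaleNr -scalerN -mulmxA -mulmxN -mulNmx.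
congr (_ *: _); congr (_ *m _); congr (_ *m _).
by rewrite scalar_mx_natS !opprD opprK addrA addrAC [- 1%:M + Q]addrC.
Qed.

End HigherDerivatives.

Unset Implicit Arguments.

Theorem theorem2p5 (R : realType) (N : nat) (Q : 'M[R[i]]_N) (n : nat)
  (hQ : eigenvalues_Re_gt Q 0) :
  (forall x : R, 0 < x ->
     let F := fun y : R => rpow_mx y (- Q) *m upper_gamma_mx Q y in
     nderivable_cmx n F x /\
     nderive_cmx n F x =
       (-1) ^+ n *:
         (rpow_mx x (- Q - (n%:R)%:M) *m upper_gamma_mx (Q + (n%:R)%:M) x)) /\
  (forall x : R, 0 < x ->
     let F := fun y : R => rpow_mx y (- Q) *m lower_gamma_mx Q y in
     nderivable_cmx n F x /\
     nderive_cmx n F x =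
       (-1) ^+ n *:
         (rpow_mx x (- Q - (n%:R)%:M) *m lower_gamma_mx (Q + (n%:R)%:M) x)) /\
  (forall x : R, 0 < x ->
     let F := fun y : R => (expR y)%:C *: upper_gamma_mx Q y in
     nderivable_cmx n F x /\
     nderive_cmx n F x =
       (-1) ^+ n *:
         (pochhammer_mx (1%:M - Q) n *m
            ((expR x)%:C *: upper_gamma_mx (Q - (n%:R)%:M) x))) /\
  (eigenvalues_Re_gt Q n%:R ->
   forall x : R, 0 < x ->
     let F := fun y : R => (expR y)%:C *: lower_gamma_mx Q y in
     nderivable_cmx n F x /\
     nderive_cmx n F x =
       (-1) ^+ n *:
         (pochhammer_mx (1%:M - Q) n *m
            ((expR x)%:C *: lower_gamma_mx (Q - (n%:R)%:M) x))).
Proof.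
have scalar0 : (0%:R)%:M = 0 :> 'M[R[i]]_N by rewrite raddf0.
have upperD (P : 'M[R[i]]_N) (y : R) : 0 < y -> upper_gamma_mx (P + 1%:M) y =
    P *m upper_gamma_mx P y - (-1) *: ((expR (- y))%:C *: rpow_mx y P).
  by move=> y0; rewrite scaleN1r opprK upper_gamma_mxD1.
have dupper (P : 'M[R[i]]_N) (y : R) : 0 < y ->
    is_mxderive (upper_gamma_mx P) y ((-1) *: gamma_kernel P y).
  by move=> y0; rewrite scaleN1r; exact: is_mxderive_upper_gamma.
have lowerD (P : 'M[R[i]]_N) (y : R) : eigenvalues_Re_gt P 0 -> 0 < y ->
    lower_gamma_mx (P + 1%:M) y =
    P *m lower_gamma_mx P y - 1 *: ((expR (- y))%:C *: rpow_mx y P).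
  by move=> hP y0; rewrite scale1r lower_gamma_mxD1.
have dlower (P : 'M[R[i]]_N) (y : R) : eigenvalues_Re_gt P 0 -> 0 < y ->
    is_mxderive (lower_gamma_mx P) y (1 *: gamma_kernel P y).
  by move=> hP y0; rewrite scale1r; exact: is_mxderive_lower_gamma.
(* Both kinds of functions are rewritten as the member of index 0 of their chain of claimed
   derivatives. *)
have powE (G : 'M[R[i]]_N -> R -> 'M[R[i]]_N) :
    (fun y => rpow_mx y (- Q) *m G Q y) = (fun y => (-1) ^+ 0 *:
      (rpow_mx y (- Q - (0%:R)%:M) *m G (Q + (0%:R)%:M) y)).
  by apply/funext => y; rewrite expr0 scale1r scalar0 subr0 addr0.
have expE (G : 'M[R[i]]_N -> R -> 'M[R[i]]_N) :
    (fun y => (expR y)%:C *: G Q y) = (fun y => (-1) ^+ 0 *: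
      (pochhammer_mx (1%:M - Q) 0 *m ((expR y)%:C *: G (Q - (0%:R)%:M) y))).
  apply/funext => y; rewrite expr0 scale1r scalar0 subr0.
  by rewrite /pochhammer_mx big_ord0 mul1mx.
split; [|split; [|split]].
- move=> x x0 F; rewrite /F (powE (@upper_gamma_mx R N)).
  apply: (@nderive_cmx_chain _ _ (fun k y => (-1) ^+ k *:
    (rpow_mx y (- Q - (k%:R)%:M) *m upper_gamma_mx (Q + (k%:R)%:M) y))) => //.
  by move=> k y _ y0; exact: (@rpow_gamma_step _ _ Q (@upper_gamma_mx R N) _ k y y0
      (dupper _ _ y0) (upperD _ _ y0)).
- move=> x x0 F; rewrite /F (powE (@lower_gamma_mx R N)).
  apply: (@nderive_cmx_chain _ _ (fun k y => (-1) ^+ k *: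
    (rpow_mx y (- Q - (k%:R)%:M) *m lower_gamma_mx (Q + (k%:R)%:M) y))) => //.
  move=> k y _ y0; have hk := eigenvalues_Re_gt_addn (k := k) hQ.
  exact: (@rpow_gamma_step _ _ Q (@lower_gamma_mx R N) _ k y y0
    (dlower _ _ hk y0) (lowerD _ _ hk y0)).
- move=> x x0 F; rewrite /F (expE (@upper_gamma_mx R N)).
  apply: (@nderive_cmx_chain _ _ (fun k y => (-1) ^+ k *:
    (pochhammer_mx (1%:M - Q) k *m
      ((expR y)%:C *: upper_gamma_mx (Q - (k%:R)%:M) y)))) => //.
  by move=> k y _ y0; exact: (@exp_gamma_step _ _ Q (@upper_gamma_mx R N) _ k y y0
      (dupper _ _ y0) (upperD _ _ y0)).
- move=> hQn x x0 F; rewrite /F (expE (@lower_gamma_mx R N)).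
  apply: (@nderive_cmx_chain _ _ (fun k y => (-1) ^+ k *:
    (pochhammer_mx (1%:M - Q) k *m
      ((expR y)%:C *: lower_gamma_mx (Q - (k%:R)%:M) y)))) => //.
  move=> k y kn y0.
  (* The derivative is taken at Q - kI and the recurrence at Q - (k+1)I; both spectra lie in the
     right half-plane because k + 1 <= n. *)
  have hk := eigenvalues_Re_gt_subn (ltnW kn) hQn.
  have hk1 := eigenvalues_Re_gt_subn kn hQn.
  exact: (@exp_gamma_step _ _ Q (@lower_gamma_mx R N) _ k y y0
    (dlower _ _ hk y0) (lowerD _ _ hk1 y0)).
Qed.
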